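(* Let $\mathcal{A}$ and $\mathcal{B}$ be Lie-Rinehart structures over locally ringed spaces $X$ and $Y$ over $\mathbb{R}$ respectively, and let $(F,f)$ be a comorphism of Lie-Rinehart structures covering $f\colon Y\to X$, with $F\colon\mathcal{A}\to f_*\mathcal{B}$. Equip $f^*\mathcal{A}$ with the Lie-Rinehart structure on $Y$ induced by the action $f_*\rho_{\mathcal{B}}\circ F\colon\mathcal{A}\to f_*\mathrm{Der}(\mathcal{O}_Y)$. Then there exists a unique comorphism $(\overline{F},\mathrm{Id}_Y)$, $\overline{F}\colon f^*\mathcal{A}\to\mathcal{B}$, such that $$(F,f)=(\overline{F},\mathrm{Id}_Y)\circ(1\otimes\mathrm{Id}_{\mathcal{A}},f),$$ that is, $F$ equals the composition $\mathcal{A}\xrightarrow{\,1\otimes\mathrm{Id}_{\mathcal{A}}\,}f_*f^*\mathcal{A}\xrightarrow{\,f_*\overline{F}\,}f_*\mathcal{B}$.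
   Context: All algebras are commutative and unital over $\mathbb{R}$. A locally ringed space over $\mathbb{R}$ is a topological space with a sheaf of $\mathbb{R}$-algebras with local stalks; morphisms are morphisms of locally ringed spaces over $\mathbb{R}$. $\mathrm{Der}(\mathcal{O}_X)$ is the sheaf of $\mathbb{R}$-linear derivations of $\mathcal{O}_X$. Lie-Rinehart (LR) structure on $X$: a sheaf $\mathcal{A}$ of $\mathcal{O}_X$-modules that is also a sheaf of real Lie algebras, with an $\mathcal{O}_X$-linear morphism of sheaves of Lie algebras (the anchor) $\rho_{\mathcal{A}}\colon\mathcal{A}\to\mathrm{Der}(\mathcal{O}_X)$, $a\mapsto\mathcal{L}_a$, such that $[a,ub]=u[a,b]+\mathcal{L}_a(u)b$. Comorphism (in the orientation used here) from $\mathcal{A}$ over $X$ to $\mathcal{B}$ over $Y$, covering $f\colon Y\to X$: a morphism of sheaves of $\mathcal{O}_X$-modules $F\colon\mathcal{A}\to f_*\mathcal{B}$ such that for all open $U\subset X$, the pair $(F_U,f^\#_U)\colon(\mathcal{A}(U),\mathcal{O}_X(U))\to(\mathcal{B}(f^{-1}U),\mathcal{O}_Y(f^{-1}U))$ is a morphism of Lie-Rinehart pairs, i.e. $F_U$ is a Lie algebra homomorphism and $f^\#(\mathcal{L}_a(r))=\mathcal{L}_{F(a)}(f^\#r)$ for $a\in\mathcal{A}(U)$, $r\in\mathcal{O}_X(U)$. A comorphism covering $\mathrm{Id}_Y$ is an $\mathcal{O}_Y$-linear map of sheaves commuting with brackets and anchors. The pullback is $f^*\mathcal{A}=\mathcal{O}_Y\otimes_{f^{-1}\mathcal{O}_X}f^{-1}\mathcal{A}$.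 The LR structure on $f^*\mathcal{A}$ induced by $\alpha=f_*\rho_{\mathcal{B}}\circ F$ is the unique one such that $\mathcal{L}_{s_1\otimes a}s_2=s_1\,(\alpha(a)s_2)$ for local sections $s_1,s_2$ of $\mathcal{O}_Y$, $a$ of $\mathcal{A}$, and such that $a\mapsto1\otimes a$, $\mathcal{A}\to f_*f^*\mathcal{A}$, is a comorphism of LR structures covering $f$. *)

(* Defs.v *)
From HB Require Import structures.
From mathcomp Require Import all_boot all_order all_algebra.
From mathcomp Require Import all_classical reals topology ring.

Set Implicit Arguments.
Unset Strict Implicit.
Unset Printing Implicit Defensive.

Import GRing.Theory.
Local Open Scope classical_set_scope.
Local Open Scope ring_scope.

Section ClassicalQuotient.
Variables (T : Type) (E : T -> T -> Prop).

Record equivalence_prop : Prop := EquivalenceProp {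
  equiv_refl : forall x, E x x;
  equiv_sym : forall x y, E x y -> E y x;
  equiv_trans : forall x y z, E x y -> E y z -> E x z }.

Hypothesis EP : equivalence_prop.

Definition equivb : rel {classic T} := fun x y => `[< E x y >].

Lemma equivb_refl : reflexive equivb.
Proof. by move=> x; apply/asboolP; exact: (equiv_refl EP). Qed.

Lemma equivb_sym : symmetric equivb.
Proof.
by move=> x y; apply: asbool_equiv_eq; split; exact: (equiv_sym EP).
Qed.

Lemma equivb_trans : transitive equivb.
Proof.
move=> y x z /asboolP xy /asboolP yz; apply/asboolP.
exact: (equiv_trans EP xy yz).
Qed.

Definition equivb_rel := EquivRel equivb equivb_refl equivb_sym equivb_trans.

Definition cquot := {eq_quot equivb_rel}%qT.
HB.instance Definition _ := Choice.on cquot.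

Definition cpi (x : T) : cquot := (\pi_({eq_quot equivb_rel}))%qT (x : {classic T}).
Definition crepr (q : cquot) : T := repr (q : {eq_quot equivb_rel}%qT).

Lemma creprK : cancel crepr cpi.
Proof. exact: reprK. Qed.

Lemma cpiP x y : cpi x = cpi y <-> E x y.
Proof.
split; first by move/(@eqmodP _ equivb_rel _ _)/asboolP.
by move=> xy; apply/(@eqmodP _ equivb_rel _ _)/asboolP.
Qed.

Lemma crepr_rel x : E (crepr (cpi x)) x.
Proof. by apply/cpiP; rewrite creprK. Qed.

End ClassicalQuotient.

Identity Coercion fun_of_set : set >-> Funclass.

Section Opens.
Variable X : topologicalType.

Record opens := Opens { oset :> set X; oset_open : open oset }.

Lemma opens_eq (U V : opens) : oset U = oset V -> U = V.
Proof.
by case: U V => [U oU] [V oV] /= e; subst V; congr Opens; exact: Prop_irrelevance.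
Qed.

Definition opensI (U V : opens) : opens :=
  Opens (openI (oset_open U) (oset_open V)).

Definition opens_bigcup (I : Type) (V : I -> opens) : opens :=
  Opens (bigcup_open (D := setT) (fun i _ => oset_open (V i))).

Lemma opensIl (U V : opens) : opensI U V `<=` U. Proof. by move=> x []. Qed.
Lemma opensIr (U V : opens) : opensI U V `<=` V. Proof. by move=> x []. Qed.

End Opens.

Definition opens_preimage (X Y : topologicalType) (f : Y -> X)
    (fc : continuous f) (U : opens X) : opens Y :=
  Opens (open_comp (fun y _ => fc y) (oset_open U)).

(** Sections are indexed by open sets only; [comPzRingType] is used because the
    ring of sections over the empty set is zero. *)
Record psh (X : topologicalType) := Psh {
  psec :> opens X -> zmodType;
  pres : forall U V : opens X, V `<=` U -> {additive psec U -> psec V};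
  pres_id : forall (U : opens X) (h : U `<=` U) s, pres h s = s;
  pres_comp : forall (U V W : opens X) (h1 : V `<=` U) (h2 : W `<=` V)
    (h : W `<=` U) s, pres h2 (pres h1 s) = pres h s }.
Arguments pres {X} p {U V} h.

Record rpsh (X : topologicalType) := RPsh {
  rsec :> opens X -> comPzRingType;
  rres : forall U V : opens X, V `<=` U -> {rmorphism rsec U -> rsec V};
  rres_id : forall (U : opens X) (h : U `<=` U) s, rres h s = s;
  rres_comp : forall (U V W : opens X) (h1 : V `<=` U) (h2 : W `<=` V)
    (h : W `<=` U) s, rres h2 (rres h1 s) = rres h s }.
Arguments rres {X} r {U V} h.

Record mpsh (X : topologicalType) (O : rpsh X) := MPsh {
  msec :> forall U : opens X, lmodType (O U);
  mres : forall U V : opens X, V `<=` U -> {additive msec U -> msec V};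
  mres_scale : forall (U V : opens X) (h : V `<=` U) (r : O U) (s : msec U),
    mres h (r *: s) = rres O h r *: mres h s;
  mres_id : forall (U : opens X) (h : U `<=` U) s, mres h s = s;
  mres_comp : forall (U V W : opens X) (h1 : V `<=` U) (h2 : W `<=` V)
    (h : W `<=` U) s, mres h2 (mres h1 s) = mres h s }.
Arguments mres {X O} m {U V} h.

Definition psh_of_rpsh (X : topologicalType) (O : rpsh X) : psh X :=
  @Psh X (fun U => O U) (fun U V h => rres O h) (@rres_id X O) (@rres_comp X O).

Definition psh_of_mpsh (X : topologicalType) (O : rpsh X) (M : mpsh O) : psh X :=
  @Psh X (fun U => M U) (fun U V h => mres M h) (@mres_id X O M) (@mres_comp X O M).

Definition is_sheaf (X : topologicalType) (P : psh X) : Prop :=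
  forall (U : opens X) (I : Type) (V : I -> opens X) (h : forall i, V i `<=` U),
    U `<=` \bigcup_i V i ->
    (forall s t : P U, (forall i, pres P (h i) s = pres P (h i) t) -> s = t) /\
    (forall s : forall i, P (V i),
       (forall i j, pres P (@opensIl X (V i) (V j)) (s i) =
                    pres P (@opensIr X (V i) (V j)) (s j)) ->
       exists t : P U, forall i, pres P (h i) t = s i).

(** [germs P S] is the colimit of [P U] over the open [U] containing [S]: for
    [S = [set x]] it is the stalk of [P] at [x], and for [S = f @` V] it is the
    value on [V] of the presheaf inverse image of [P] along [f]. *)
Section Germs.
Variables (X : topologicalType) (P : psh X) (S : set X).

Record pregerm := PreGerm {
  pg_dom : opens X;
  pg_sub : S `<=` pg_dom;
  pg_sec : P pg_dom }.

Definition germ_eq (a b : pregerm) : Prop :=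
  exists (W : opens X) (ha : W `<=` pg_dom a) (hb : W `<=` pg_dom b),
    S `<=` W /\ pres P ha (pg_sec a) = pres P hb (pg_sec b).

Lemma germ_eq_equiv : equivalence_prop germ_eq.
Proof.
split.
- by move=> a; exists (pg_dom a), (@subset_refl _ _), (@subset_refl _ _);
    split => //; exact: pg_sub.
- by move=> a b [W [ha [hb [SW e]]]]; exists W, hb, ha.
- move=> a b c [W [ha [hb [SW e]]]] [W' [hb' [hc [SW' e']]]].
  pose l := @opensIl X W W'; pose r := @opensIr X W W'.
  exists (opensI W W'), (subset_trans l ha), (subset_trans r hc); split.
    by move=> x Sx; split; [exact: SW|exact: SW'].
  rewrite -(pres_comp ha l) e (pres_comp _ _ (subset_trans l hb)).
  by rewrite -(pres_comp hc r) -e' (pres_comp _ _ (subset_trans l hb)).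
Qed.

Definition germs := cquot germ_eq_equiv.
HB.instance Definition _ := Choice.on germs.

Definition germ (U : opens X) (h : S `<=` U) (s : P U) : germs :=
  cpi germ_eq_equiv (PreGerm h s).

Lemma germP (g : germs) : exists (U : opens X) (h : S `<=` U) (s : P U), g = germ h s.
Proof.
exists (pg_dom (crepr g)), (@pg_sub (crepr g)), (pg_sec (crepr g)).
by rewrite /germ -[LHS]creprK; congr cpi; case: (crepr g).
Qed.

Lemma germ_eqP (U : opens X) (h : S `<=` U) (s : P U) (V : opens X) (k : S `<=` V) (t : P V) :
  germ h s = germ k t <->
  exists (W : opens X) (ha : W `<=` U) (hb : W `<=` V),
    S `<=` W /\ pres P ha s = pres P hb t.
Proof. exact: cpiP. Qed.

Lemma germ_res (U V : opens X) (h : S `<=` U) (k : S `<=` V) (VU : V `<=` U) (s : P U) :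
  germ k (pres P VU s) = germ h s.
Proof.
apply/germ_eqP; exists V, (@subset_refl _ _), VU; split => //.
by rewrite pres_id.
Qed.

Lemma germ_irr (U : opens X) (h k : S `<=` U) (s : P U) : germ h s = germ k s.
Proof. by rewrite (Prop_irrelevance h k). Qed.

Section GermLift.
Variables (T : Type) (phi : forall U : opens X, S `<=` U -> P U -> T).
Definition germ_lift (g : germs) : T :=
  phi (@pg_sub (crepr g)) (pg_sec (crepr g)).
Hypothesis phi_res : forall (U V : opens X) (h : S `<=` U) (k : S `<=` V)
  (VU : V `<=` U) (s : P U), phi k (pres P VU s) = phi h s.
Lemma germ_liftE (U : opens X) (h : S `<=` U) (s : P U) : germ_lift (germ h s) = phi h s.
Proof.
rewrite /germ_lift; have [W [ha [hb [SW /= e]]]] :=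
  crepr_rel germ_eq_equiv (PreGerm h s).
by rewrite -(phi_res _ SW ha) e; exact: phi_res.
Qed.
End GermLift.

End Germs.

Section GermOp.
Variables (X : topologicalType) (P Q R : psh X) (S : set X).
Variable op : forall U : opens X, P U -> Q U -> R U.
Definition germ_op (g : germs P S) (g' : germs Q S) : germs R S :=
  let a := crepr g in let b := crepr g' in
  germ (U := opensI (pg_dom a) (pg_dom b))
    (fun x Sx => conj (pg_sub a Sx) (pg_sub b Sx))
    (op (pres P (@opensIl X _ _) (pg_sec a)) (pres Q (@opensIr X _ _) (pg_sec b))).
Hypothesis op_res : forall (U V : opens X) (h : V `<=` U) s t,
  pres R h (op s t) = op (pres P h s) (pres Q h t).
Lemma germ_opE (U : opens X) (h : S `<=` U) s t :
  germ_op (germ h s) (germ h t) = germ h (op s t).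
Proof.
rewrite /germ_op.
have := crepr_rel (germ_eq_equiv P S) (PreGerm h s).
have := crepr_rel (germ_eq_equiv Q S) (PreGerm h t).
rewrite -!/(germ h _); move: (crepr (germ h s)) (crepr (germ h t)).
move=> [Va ka sa] [Vb kb sb] [W [ha [hb [SW /= e]]]] [W' [ha' [hb' [SW' /= e']]]].
pose l := @opensIl X W W'; pose r := @opensIr X W W'.
apply/germ_eqP; exists (opensI W W').
exists (fun x p => conj (ha' x (r x p)) (ha x (l x p))), (subset_trans l hb); split.
  by move=> x Sx; split; [exact: SW|exact: SW'].
rewrite !op_res; congr op.
- rewrite (pres_comp _ _ (subset_trans r ha')) -(pres_comp ha' r) e'.
  by rewrite (pres_comp _ _ (subset_trans l hb)).
- rewrite (pres_comp _ _ (subset_trans l ha)) -(pres_comp ha l) e.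
  by rewrite (pres_comp _ _ (subset_trans l hb)).
Qed.
End GermOp.

Lemma germP3 (X : topologicalType) (P Q R : psh X) (S : set X) (g : germs P S)
    (g' : germs Q S) (g'' : germs R S) :
  exists (U : opens X) (h : S `<=` U) s s' s'',
    [/\ g = germ h s, g' = germ h s' & g'' = germ h s''].
Proof.
have [U [h [s ->]]] := germP g; have [V [k [t ->]]] := germP g'.
have [W [l [u ->]]] := germP g''.
pose J := opensI U (opensI V W).
have SJ : S `<=` J by move=> x Sx; split; [exact: h|split; [exact: k|exact: l]].
have JU : J `<=` U by exact: opensIl.
have JV : J `<=` V by move=> x [_ []].
have JW : J `<=` W by move=> x [_ []].
by exists J, SJ, (pres P JU s), (pres Q JV t), (pres R JW u); rewrite !germ_res.
Qed.

Lemma germP2 (X : topologicalType) (P Q : psh X) (S : set X) (g : germs P S)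
    (g' : germs Q S) :
  exists (U : opens X) (h : S `<=` U) s s', g = germ h s /\ g' = germ h s'.
Proof. by have [U [h [s [s' [_ [-> -> _]]]]]] := germP3 g g' g'; exists U, h, s, s'. Qed.

Definition opensT (X : topologicalType) : opens X := Opens openT.

Section GermsZmod.
Variables (X : topologicalType) (P : psh X) (S : set X).
Implicit Types g : germs P S.

Definition germ0 : germs P S := germ (U := opensT X) (@subsetT _ _) 0.
Definition germ_opp g : germs P S :=
  germ_lift (fun (U : opens X) (h : S `<=` U) s => germ h (- s)) g.
Definition germ_add : germs P S -> germs P S -> germs P S :=
  germ_op (fun U => +%R).

Lemma germ0E (U : opens X) (h : S `<=` U) : germ h 0 = germ0.
Proof. by rewrite /germ0 -(germ_res _ h (V := U) (U := opensT X) (@subsetT _ _)) raddf0. Qed.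

Lemma germ_oppE (U : opens X) (h : S `<=` U) s :
  germ_opp (germ h s) = germ h (- s).
Proof.
rewrite /germ_opp germ_liftE // => {U h s} U V h k VU s.
by rewrite -raddfN germ_res.
Qed.

Lemma germ_addE (U : opens X) (h : S `<=` U) s t :
  germ_add (germ h s) (germ h t) = germ h (s + t).
Proof. by apply: germ_opE => {U h s t} U V h s t; rewrite raddfD. Qed.

Lemma germ_addA : associative germ_add.
Proof.
move=> x y z; have [U [h [s [s' [s'' [-> -> ->]]]]]] := germP3 x y z.
by rewrite !germ_addE addrA.
Qed.
Lemma germ_addC : commutative germ_add.
Proof.
move=> x y; have [U [h [s [s' [-> ->]]]]] := germP2 x y.
by rewrite !germ_addE addrC.
Qed.
Lemma germ_add0 : left_id germ0 germ_add.
Proof.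
by move=> x; have [U [h [s ->]]] := germP x; rewrite -(germ0E h) germ_addE add0r.
Qed.
Lemma germ_addN : left_inverse germ0 germ_opp germ_add.
Proof.
move=> x; have [U [h [s ->]]] := germP x.
by rewrite germ_oppE germ_addE addNr germ0E.
Qed.

HB.instance Definition _ := GRing.isZmodule.Build (germs P S)
  germ_addA germ_addC germ_add0 germ_addN.

Lemma germ_is_additive (U : opens X) (h : S `<=` U) : zmod_morphism (germ (P := P) h).
Proof. by move=> s t; rewrite -germ_addE -germ_oppE. Qed.
HB.instance Definition _ (U : opens X) (h : S `<=` U) :=
  GRing.isZmodMorphism.Build (P U) (germs P S) (germ h) (germ_is_additive h).

End GermsZmod.

Section GermsRing.
Variables (X : topologicalType) (O : rpsh X) (S : set X).

Definition rgerms := germs (psh_of_rpsh O) S.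
HB.instance Definition _ := GRing.Zmodule.on rgerms.

Definition rgerm (U : opens X) (h : S `<=` U) (s : O U) : rgerms :=
  germ (P := psh_of_rpsh O) h s.

Definition germ_one : rgerms := rgerm (U := opensT X) (@subsetT _ _) 1.
Definition germ_mul : rgerms -> rgerms -> rgerms :=
  germ_op (P := psh_of_rpsh O) (Q := psh_of_rpsh O) (R := psh_of_rpsh O)
    (fun U (s t : O U) => s * t).

Lemma germ_oneE (U : opens X) (h : S `<=` U) : rgerm h 1 = germ_one.
Proof.
rewrite /germ_one /rgerm.
by rewrite -(germ_res (P := psh_of_rpsh O) (U := opensT X) _ h (@subsetT _ _)) /= rmorph1.
Qed.

Lemma germ_mulE (U : opens X) (h : S `<=` U) s t :
  germ_mul (rgerm h s) (rgerm h t) = rgerm h (s * t).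
Proof. by apply: germ_opE => {U h s t} U V h s t /=; rewrite rmorphM. Qed.

Lemma rgerm_add (U : opens X) (h : S `<=` U) s t :
  rgerm h s + rgerm h t = rgerm h (s + t).
Proof. exact: germ_addE. Qed.

Lemma germ_mulA : associative germ_mul.
Proof.
move=> x y z; have [U [h [s [s' [s'' [-> -> ->]]]]]] := germP3 x y z.
by rewrite !germ_mulE mulrA.
Qed.
Lemma germ_mulC : commutative germ_mul.
Proof.
move=> x y; have [U [h [s [s' [-> ->]]]]] := germP2 x y.
by rewrite !germ_mulE mulrC.
Qed.
Lemma germ_mul1 : left_id germ_one germ_mul.
Proof.
by move=> x; have [U [h [s ->]]] := germP x; rewrite -(germ_oneE h) germ_mulE mul1r.
Qed.
Lemma germ_mulDl : left_distributive germ_mul +%R.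
Proof.
move=> x y z; have [U [h [s [s' [s'' [-> -> ->]]]]]] := germP3 x y z.
by rewrite rgerm_add !germ_mulE rgerm_add mulrDl.
Qed.

HB.instance Definition _ := GRing.Zmodule_isComPzRing.Build rgerms
  germ_mulA germ_mulC germ_mul1 germ_mulDl.

Lemma rgerm_is_additive (U : opens X) (h : S `<=` U) : zmod_morphism (rgerm h).
Proof. exact: (germ_is_additive (P := psh_of_rpsh O)). Qed.
Lemma rgerm_is_monoid (U : opens X) (h : S `<=` U) : monoid_morphism (rgerm h).
Proof. by split => [|s t]; [exact: germ_oneE|rewrite -germ_mulE]. Qed.
HB.instance Definition _ (U : opens X) (h : S `<=` U) :=
  GRing.isZmodMorphism.Build (O U) rgerms (rgerm h) (rgerm_is_additive h).
HB.instance Definition _ (U : opens X) (h : S `<=` U) :=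
  GRing.isMonoidMorphism.Build (O U) rgerms (rgerm h) (rgerm_is_monoid h).

End GermsRing.

Section GermsMod.
Variables (X : topologicalType) (O : rpsh X) (M : mpsh O) (S : set X).

Definition mgerms := germs (psh_of_mpsh M) S.
HB.instance Definition _ := GRing.Zmodule.on mgerms.

Definition mgerm (U : opens X) (h : S `<=` U) (s : M U) : mgerms :=
  germ (P := psh_of_mpsh M) h s.

Definition germ_scale : rgerms O S -> mgerms -> mgerms :=
  germ_op (P := psh_of_rpsh O) (Q := psh_of_mpsh M) (R := psh_of_mpsh M)
    (fun U (r : O U) (s : M U) => r *: s).

Lemma germ_scaleE (U : opens X) (h : S `<=` U) r s :
  germ_scale (rgerm h r) (mgerm h s) = mgerm h (r *: s).
Proof. by apply: germ_opE => {U h r s} U V h r s /=; rewrite mres_scale. Qed.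

Lemma mgerm_add (U : opens X) (h : S `<=` U) s t :
  mgerm h s + mgerm h t = mgerm h (s + t).
Proof. exact: germ_addE. Qed.

Lemma germ_scaleA (a b : rgerms O S) (v : mgerms) :
  germ_scale a (germ_scale b v) = germ_scale (a * b) v.
Proof.
have [U [h [s [s' [s'' [-> -> ->]]]]]] := germP3 a b v.
by rewrite !germ_scaleE -/(rgerm h s) -rmorphM /= germ_scaleE scalerA.
Qed.
Lemma germ_scale1 : left_id 1 germ_scale.
Proof.
move=> x; have [U [h [s ->]]] := germP x.
by rewrite -[X in germ_scale X](rmorph1 (rgerm h)) germ_scaleE scale1r.
Qed.
Lemma germ_scaleDr : right_distributive germ_scale +%R.
Proof.
move=> x y z; have [U [h [s [s' [s'' [-> -> ->]]]]]] := germP3 x y z.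
by rewrite mgerm_add !germ_scaleE mgerm_add scalerDr.
Qed.
Lemma germ_scaleDl (v : mgerms) : {morph germ_scale^~ v : a b / a + b}.
Proof.
move=> x y; have [U [h [s [s' [s'' [-> -> ->]]]]]] := germP3 x y v.
by rewrite rgerm_add !germ_scaleE mgerm_add scalerDl.
Qed.

HB.instance Definition _ := GRing.Zmodule_isLmodule.Build (rgerms O S) mgerms
  germ_scaleA germ_scale1 germ_scaleDr germ_scaleDl.

Lemma mgerm_scale (U : opens X) (h : S `<=` U) r s :
  mgerm h (r *: s) = rgerm h r *: mgerm h s.
Proof. by rewrite -germ_scaleE. Qed.

End GermsMod.

Definition stalk (X : topologicalType) (P : psh X) (x : X) := germs P [set x].
HB.instance Definition _ X P x := GRing.Zmodule.on (@stalk X P x).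

Lemma sub_set1 (T : Type) (x : T) (U : set T) : U x -> [set x] `<=` U.
Proof. by move=> Ux y ->. Qed.

Definition germ_at (X : topologicalType) (P : psh X) (U : opens X) (x : X)
  (Ux : U x) (s : P U) : stalk P x := germ (sub_set1 Ux) s.

Lemma sheaf_stalk_inj (X : topologicalType) (P : psh X) (hP : is_sheaf P)
    (U : opens X) (s t : P U) :
  (forall x (Ux : U x), germ_at Ux s = germ_at Ux t) -> s = t.
Proof.
move=> st.
have loc (x : {x | U x}) : {W : opens X | exists h : W `<=` U,
    W (sval x) /\ pres P h s = pres P h t}.
  apply: cid; case: x => x Ux /=.
  have /germ_eqP [W [ha [hb [xW e]]]] := st x Ux.
  exists W, ha; split; first exact: xW.
  by rewrite e (Prop_irrelevance hb ha).
pose h x := sval (cid (svalP (loc x))).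
have hW x := svalP (cid (svalP (loc x))).
have [|inj _] := hP U _ (fun x => sval (loc x)) h.
  by move=> x Ux; exists (exist _ x Ux) => //; have [] := hW (exist _ x Ux).
by apply: inj => x; have [] := hW x.
Qed.

(** Sections of the sheafification over [U]: families of germs that are locally
    induced by sections of [P]. *)
Section Sheafification.
Variables (X : topologicalType) (P : psh X).

Section Sections.
Variable U : opens X.

Record shsec := ShSec {
  shf :> forall x, U x -> stalk P x;
  shf_loc : forall x, U x -> exists (V : opens X) (VU : V `<=` U) (t : P V),
    V x /\ forall y (Vy : V y), shf (VU y Vy) = germ_at Vy t }.

Lemma shsec_eq (s t : shsec) : (forall x (Ux : U x), s x Ux = t x Ux) -> s = t.
Proof.
case: s t => [s hs] [t ht] /= st.
have {}st : s = t by apply: functional_extensionality_dep => x; apply: funext => Ux.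
by subst t; congr ShSec; exact: Prop_irrelevance.
Qed.

HB.instance Definition _ := gen_eqMixin shsec.
HB.instance Definition _ := gen_choiceMixin shsec.

Lemma germ_at_irr x (h k : U x) (s : shsec) : s x h = s x k.
Proof. by rewrite (Prop_irrelevance h k). Qed.

End Sections.

Lemma germ_at_res (U V : opens X) (VU : V `<=` U) x (Vx : V x) (Ux : U x) (s : P U) :
  germ_at Vx (pres P VU s) = germ_at Ux s.
Proof. exact: germ_res. Qed.

Lemma shsec_res_loc (U V : opens X) (h : V `<=` U) (s : shsec U) x (Vx : V x) :
  exists (W : opens X) (WV : W `<=` V) (t : P W),
    W x /\ forall y (Wy : W y), s y (h y (WV y Wy)) = germ_at Wy t.
Proof.
have [W [WU [t [Wx e]]]] := shf_loc s (h x Vx).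
exists (opensI W V), (@opensIr X W V), (pres P (@opensIl X W V) t); split => //.
move=> y [Wy Vy]; rewrite (germ_at_res _ _ Wy) -e; exact: germ_at_irr.
Qed.

Definition shres (U V : opens X) (h : V `<=` U) (s : shsec U) : shsec V :=
  @ShSec V (fun x Vx => s x (h x Vx)) (@shsec_res_loc U V h s).

Lemma sh_of_loc (U : opens X) (s : P U) x (Ux : U x) :
  exists (V : opens X) (VU : V `<=` U) (t : P V),
    V x /\ forall y (Vy : V y), germ_at (VU y Vy) s = germ_at Vy t.
Proof.
exists U, (@subset_refl _ _), s; split=> // y Uy; exact: germ_irr.
Qed.

Definition sh_of (U : opens X) (s : P U) : shsec U := @ShSec U (fun x Ux => germ_at Ux s) (sh_of_loc s).

End Sheafification.

Section ShOp.
Variables (X : topologicalType) (P Q R : psh X).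
Variable op : forall U : opens X, P U -> Q U -> R U.
Hypothesis op_res : forall (U V : opens X) (h : V `<=` U) s t,
  pres R h (op s t) = op (pres P h s) (pres Q h t).

Lemma sh_op_loc (U : opens X) (s : shsec P U) (t : shsec Q U) x (Ux : U x) :
  exists (V : opens X) (VU : V `<=` U) (u : R V), V x /\
    forall y (Vy : V y), germ_op op (s y (VU y Vy)) (t y (VU y Vy)) = germ_at Vy u.
Proof.
have [V [VU [a [Vx ea]]]] := shf_loc s Ux.
have [W [WU [b [Wx eb]]]] := shf_loc t Ux.
exists (opensI V W), (subset_trans (@opensIl X V W) VU).
exists (op (pres P (@opensIl X V W) a) (pres Q (@opensIr X V W) b)); split=> //.
move=> y [Vy Wy].
rewrite -[RHS](germ_opE op_res).
rewrite (germ_res (sub_set1 Vy) (sub_set1 (conj Vy Wy : opensI V W y))).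
rewrite (germ_res (sub_set1 Wy) (sub_set1 (conj Vy Wy : opensI V W y))).
rewrite -/(germ_at Vy a) -/(germ_at Wy b) -ea -eb.
by congr germ_op; exact: germ_at_irr.
Qed.

Definition sh_op (U : opens X) (s : shsec P U) (t : shsec Q U) : shsec R U :=
  @ShSec X R U (fun x Ux => germ_op op (s x Ux) (t x Ux)) (sh_op_loc s t).
End ShOp.

Section ShZmod.
Variables (X : topologicalType) (P : psh X) (U : opens X).

Lemma add_res (V W : opens X) (h : W `<=` V) (s t : P V) :
  pres P h (s + t) = pres P h s + pres P h t.
Proof. exact: raddfD. Qed.

Definition sh_add : shsec P U -> shsec P U -> shsec P U := sh_op add_res (U := U).
Definition sh_zero : shsec P U := sh_of 0.

Lemma sh_opp_loc (s : shsec P U) x (Ux : U x) :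
  exists (V : opens X) (VU : V `<=` U) (t : P V),
    V x /\ forall y (Vy : V y), - s y (VU y Vy) = germ_at Vy t.
Proof.
have [V [VU [a [Vx ea]]]] := shf_loc s Ux.
exists V, VU, (- a); split => // y Vy; rewrite ea; exact: germ_oppE.
Qed.
Definition sh_opp (s : shsec P U) : shsec P U := @ShSec X P U (fun x Ux => - s x Ux) (sh_opp_loc s).

Lemma sh_addE s t x (Ux : U x) : sh_add s t x Ux = s x Ux + t x Ux.
Proof. by []. Qed.
Lemma sh_zeroE x (Ux : U x) : sh_zero x Ux = 0.
Proof. exact: germ0E. Qed.

Lemma sh_addA : associative sh_add.
Proof. by move=> s t u; apply: shsec_eq => x Ux; rewrite !sh_addE addrA. Qed.
Lemma sh_addC : commutative sh_add.
Proof. by move=> s t; apply: shsec_eq => x Ux; rewrite !sh_addE addrC. Qed.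
Lemma sh_add0 : left_id sh_zero sh_add.
Proof. by move=> s; apply: shsec_eq => x Ux; rewrite !sh_addE sh_zeroE add0r. Qed.
Lemma sh_addN : left_inverse sh_zero sh_opp sh_add.
Proof.
by move=> s; apply: shsec_eq => x Ux; rewrite sh_addE sh_zeroE [X in X + _]/= addNr.
Qed.
HB.instance Definition _ := GRing.isZmodule.Build (shsec P U)
  sh_addA sh_addC sh_add0 sh_addN.
End ShZmod.

Section ShPsh.
Variables (X : topologicalType) (P : psh X).

Lemma shres_is_additive (U V : opens X) (h : V `<=` U) :
  zmod_morphism (shres (P := P) h).
Proof. by move=> s t; apply: shsec_eq. Qed.
HB.instance Definition _ (U V : opens X) (h : V `<=` U) :=
  GRing.isZmodMorphism.Build _ _ (shres (P := P) h) (shres_is_additive h).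

Lemma shres_id (U : opens X) (h : U `<=` U) (s : shsec P U) : shres h s = s.
Proof. by apply: shsec_eq => x Ux /=; exact: germ_at_irr. Qed.
Lemma shres_comp (U V W : opens X) (h1 : V `<=` U) (h2 : W `<=` V)
    (h : W `<=` U) (s : shsec P U) : shres h2 (shres h1 s) = shres h s.
Proof. by apply: shsec_eq => x Ux /=; exact: germ_at_irr. Qed.

Definition sheafify : psh X :=
  @Psh X (shsec P) (fun U V h => shres h) shres_id shres_comp.

Lemma sheafify_is_sheaf : is_sheaf sheafify.
Proof.
move=> U I V h cov; split=> [s t st|s cs].
  apply: shsec_eq => x Ux; have [i _ Vix] := cov x Ux.
  have /(congr1 (fun u : shsec P (V i) => u x Vix)) := st i.
  by rewrite /= !(germ_at_irr _ Ux).
have cov' x : U x -> exists i, V i x by move=> /cov[i _ ?]; exists i.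
pose F x (Ux : U x) : stalk P x :=
  let i := cid (cov' x Ux) in s (sval i) x (svalP i).
have FE x (Ux : U x) i (Vix : V i x) : F x Ux = s i x Vix.
  rewrite /F; case: cid => j Vjx /=.
  have /(congr1 (fun u : shsec P (opensI (V j) (V i)) => u x (conj Vjx Vix))) := cs j i.
  move=> /= e; etransitivity; first exact: (germ_at_irr _ (opensIl (conj Vjx Vix))).
  by rewrite e; exact: germ_at_irr.
have Floc x (Ux : U x) : exists (W : opens X) (WU : W `<=` U) (t : P W),
    W x /\ forall y (Wy : W y), F y (WU y Wy) = germ_at Wy t.
  have [i Vix] := cov' x Ux; have [W [WV [t [Wx e]]]] := shf_loc (s i) Vix.
  exists W, (subset_trans WV (h i)), t; split => // y Wy.
  by rewrite (FE _ _ i (WV y Wy)) e.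
exists (@ShSec X P U F Floc) => i; apply: shsec_eq => x Vix /=; exact: FE.
Qed.

Lemma sh_of_is_additive (U : opens X) : zmod_morphism (@sh_of X P U).
Proof. by move=> s t; apply: shsec_eq => x Ux; exact: raddfB. Qed.
HB.instance Definition _ (U : opens X) :=
  GRing.isZmodMorphism.Build (P U) (shsec P U) (@sh_of X P U) (@sh_of_is_additive U).

Lemma sh_of_res (U V : opens X) (h : V `<=` U) (s : P U) :
  sh_of (pres P h s) = shres h (sh_of s).
Proof. by apply: shsec_eq => x Vx; exact: germ_at_res. Qed.

End ShPsh.

Section ShRing.
Variables (X : topologicalType) (O : rpsh X).
Notation OP := (psh_of_rpsh O).

Definition rshsec (U : opens X) := shsec OP U.
HB.instance Definition _ U := GRing.Zmodule.on (rshsec U).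

Lemma mul_res (V W : opens X) (h : W `<=` V) (s t : O V) :
  rres O h (s * t) = rres O h s * rres O h t.
Proof. exact: rmorphM. Qed.

Definition rsh_of (U : opens X) (s : O U) : rshsec U := sh_of (P := OP) s.
Definition sh_mul (U : opens X) : rshsec U -> rshsec U -> rshsec U :=
  sh_op (P := OP) (Q := OP) (R := OP) mul_res (U := U).

Definition rshf (U : opens X) (s : rshsec U) x (Ux : U x) : rgerms O [set x] :=
  s x Ux.

Lemma rshsec_eq (U : opens X) (s t : rshsec U) :
  (forall x (Ux : U x), rshf s Ux = rshf t Ux) -> s = t.
Proof. exact: shsec_eq. Qed.

Lemma rshf_mul U (s t : rshsec U) x (Ux : U x) :
  rshf (sh_mul s t) Ux = rshf s Ux * rshf t Ux.
Proof. by []. Qed.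
Lemma rshf_add U (s t : rshsec U) x (Ux : U x) :
  rshf (s + t) Ux = rshf s Ux + rshf t Ux.
Proof. by []. Qed.
Lemma rshf_one (U : opens X) x (Ux : U x) : rshf (rsh_of (1 : O U)) Ux = 1.
Proof. exact: germ_oneE. Qed.

Lemma sh_mulA U : associative (@sh_mul U).
Proof. by move=> s t u; apply: rshsec_eq => x Ux; rewrite !rshf_mul mulrA. Qed.
Lemma sh_mulC U : commutative (@sh_mul U).
Proof. by move=> s t; apply: rshsec_eq => x Ux; rewrite !rshf_mul mulrC. Qed.
Lemma sh_mul1 U : left_id (rsh_of 1) (@sh_mul U).
Proof. by move=> s; apply: rshsec_eq => x Ux; rewrite rshf_mul rshf_one mul1r. Qed.
Lemma sh_mulDl U : left_distributive (@sh_mul U) +%R.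
Proof.
by move=> s t u; apply: rshsec_eq => x Ux; rewrite !(rshf_mul, rshf_add) mulrDl.
Qed.
HB.instance Definition _ U := GRing.Zmodule_isComPzRing.Build (rshsec U)
  (@sh_mulA U) (@sh_mulC U) (@sh_mul1 U) (@sh_mulDl U).

Lemma rsh_of_is_additive (U : opens X) : zmod_morphism (@rsh_of U).
Proof. exact: (sh_of_is_additive (P := OP)). Qed.
Lemma rsh_of_is_monoid (U : opens X) : monoid_morphism (@rsh_of U).
Proof.
split=> // s t; apply: rshsec_eq => x Ux.
by rewrite rshf_mul; exact: (rmorphM (@rgerm X O [set x] U (sub_set1 Ux))).
Qed.
HB.instance Definition _ (U : opens X) :=
  GRing.isZmodMorphism.Build (O U) (rshsec U) (@rsh_of U) (@rsh_of_is_additive U).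
HB.instance Definition _ (U : opens X) :=
  GRing.isMonoidMorphism.Build (O U) (rshsec U) (@rsh_of U) (@rsh_of_is_monoid U).

Definition rshres (U V : opens X) (h : V `<=` U) : rshsec U -> rshsec V :=
  shres (P := OP) h.
Lemma rshres_is_additive (U V : opens X) (h : V `<=` U) : zmod_morphism (rshres h).
Proof. exact: (shres_is_additive (P := OP)). Qed.
Lemma rshres_is_monoid (U V : opens X) (h : V `<=` U) : monoid_morphism (rshres h).
Proof.
split=> [|s t]; apply: rshsec_eq => x Ux //.
by rewrite rshf_one; exact: rshf_one.
Qed.
HB.instance Definition _ (U V : opens X) (h : V `<=` U) :=
  GRing.isZmodMorphism.Build (rshsec U) (rshsec V) (rshres h) (rshres_is_additive h).
HB.instance Definition _ (U V : opens X) (h : V `<=` U) :=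
  GRing.isMonoidMorphism.Build (rshsec U) (rshsec V) (rshres h) (rshres_is_monoid h).

Definition rsheafify : rpsh X :=
  @RPsh X rshsec (fun U V h => rshres h)
    (@shres_id X OP) (@shres_comp X OP).

End ShRing.

Section ShMod.
Variables (X : topologicalType) (O : rpsh X) (M : mpsh O).
Notation OP := (psh_of_rpsh O).
Notation MP := (psh_of_mpsh M).

Definition mshsec (U : opens X) := shsec MP U.
HB.instance Definition _ U := GRing.Zmodule.on (mshsec U).

Definition msh_of (U : opens X) (s : M U) : mshsec U := sh_of (P := MP) s.
Definition sh_scale (U : opens X) : rshsec O U -> mshsec U -> mshsec U :=
  sh_op (P := OP) (Q := MP) (R := MP) (@mres_scale X O M) (U := U).

Definition mshf (U : opens X) (s : mshsec U) x (Ux : U x) : mgerms M [set x] :=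
  s x Ux.

Lemma mshsec_eq (U : opens X) (s t : mshsec U) :
  (forall x (Ux : U x), mshf s Ux = mshf t Ux) -> s = t.
Proof. exact: shsec_eq. Qed.

Lemma mshf_scale U (r : rshsec O U) (s : mshsec U) x (Ux : U x) :
  mshf (sh_scale r s) Ux = rshf r Ux *: mshf s Ux.
Proof. by []. Qed.
Lemma mshf_add U (s t : mshsec U) x (Ux : U x) :
  mshf (s + t) Ux = mshf s Ux + mshf t Ux.
Proof. by []. Qed.

Lemma sh_scaleA U (a b : rshsec O U) (v : mshsec U) :
  sh_scale a (sh_scale b v) = sh_scale (a * b) v.
Proof. by apply: mshsec_eq => x Ux; rewrite !mshf_scale scalerA. Qed.
Lemma sh_scale1 U : left_id 1 (@sh_scale U).
Proof.
by move=> v; apply: mshsec_eq => x Ux; rewrite mshf_scale [rshf _ _]rshf_one scale1r.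
Qed.
Lemma sh_scaleDr U : right_distributive (@sh_scale U) +%R.
Proof.
by move=> r s t; apply: mshsec_eq => x Ux; rewrite !(mshf_scale, mshf_add) scalerDr.
Qed.
Lemma sh_scaleDl U (v : mshsec U) : {morph (@sh_scale U)^~ v : a b / a + b}.
Proof.
by move=> r s; apply: mshsec_eq => x Ux; rewrite !(mshf_scale, mshf_add, rshf_add) scalerDl.
Qed.
HB.instance Definition _ U := GRing.Zmodule_isLmodule.Build (rshsec O U) (mshsec U)
  (@sh_scaleA U) (@sh_scale1 U) (@sh_scaleDr U) (@sh_scaleDl U).

Definition mshres (U V : opens X) (h : V `<=` U) : mshsec U -> mshsec V :=
  shres (P := MP) h.
Lemma mshres_is_additive (U V : opens X) (h : V `<=` U) : zmod_morphism (mshres h).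
Proof. exact: (shres_is_additive (P := MP)). Qed.
HB.instance Definition _ (U V : opens X) (h : V `<=` U) :=
  GRing.isZmodMorphism.Build (mshsec U) (mshsec V) (mshres h) (mshres_is_additive h).

Lemma mshres_scale (U V : opens X) (h : V `<=` U) (r : rshsec O U) (s : mshsec U) :
  mshres h (r *: s) = rshres h r *: mshres h s.
Proof. exact: mshsec_eq. Qed.

Definition msheafify : mpsh (rsheafify O) :=
  @MPsh X (rsheafify O) mshsec (fun U V h => mshres h) mshres_scale
    (@shres_id X MP) (@shres_comp X MP).

Lemma msh_of_scale (U : opens X) (r : O U) (s : M U) :
  msh_of (r *: s) = rsh_of r *: msh_of s.
Proof. by apply: mshsec_eq => x Ux; exact: mgerm_scale. Qed.

End ShMod.

(** The extension of a presheaf morphism [P -> Q], with [Q] a sheaf, to the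
    sheafification of [P]. *)
Section ShExt.
Variables (X : topologicalType) (P Q : psh X) (hQ : is_sheaf Q).
Variable c : forall U : opens X, P U -> Q U.
Hypothesis c_res : forall (U V : opens X) (h : V `<=` U) s,
  pres Q h (c s) = c (pres P h s).

Definition stalk_map x (g : stalk P x) : stalk Q x :=
  germ_lift (fun (U : opens X) (h : [set x] `<=` U) s => germ h (c s)) g.

Lemma stalk_mapE (U : opens X) x (h : [set x] `<=` U) (s : P U) :
  stalk_map (germ h s) = germ h (c s).
Proof.
rewrite /stalk_map germ_liftE // => {U h s} U V h k VU s.
by rewrite -c_res germ_res.
Qed.

Lemma sh_ext_subproof (U : opens X) (s : shsec P U) :
  exists q : Q U, forall x (Ux : U x), germ_at Ux q = stalk_map (s x Ux).
Proof.
have loc (x : {x | U x}) : {W : opens X | exists (h : W `<=` U) (t : P W),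
    W (sval x) /\ forall y (Wy : W y), s y (h y Wy) = germ_at Wy t}.
  by apply: cid; case: x => x Ux; exact: shf_loc.
pose V x := sval (loc x).
have hV x : V x `<=` U by have [h _] := svalP (loc x).
have tV x : {t : P (V x) | forall y (Vy : V x y), s y (hV x y Vy) = germ_at Vy t}.
  apply: cid; have [h [t [_ e]]] := svalP (loc x); exists t => y Vy.
  by rewrite -e; exact: germ_at_irr.
have Vx x : V x (sval x) by have [h [t []]] := svalP (loc x).
have [|_ glue] := hQ hV; first by move=> x Ux; exists (exist _ x Ux) => //; exact: Vx.
have [|q qE] := glue (fun x => c (sval (tV x))).
  move=> i j; apply: (sheaf_stalk_inj hQ) => y [iy jy].
  rewrite (germ_at_res _ _ iy) (germ_at_res _ _ jy) /germ_at -!stalk_mapE.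
  rewrite -!/(germ_at _ _) -(svalP (tV i)) -(svalP (tV j)).
  by congr stalk_map; exact: germ_at_irr.
exists q => x Ux; pose x' : {x | U x} := exist _ x Ux.
rewrite -(germ_at_res (hV x') (Vx x')) qE /germ_at -stalk_mapE.
rewrite -!/(germ_at _ _) -(svalP (tV x')) .
by congr stalk_map; exact: germ_at_irr.
Qed.

Definition sh_ext (U : opens X) (s : shsec P U) : Q U :=
  sval (cid (sh_ext_subproof s)).

Lemma sh_extE (U : opens X) (s : shsec P U) x (Ux : U x) :
  germ_at Ux (sh_ext s) = stalk_map (s x Ux).
Proof. exact: (svalP (cid (sh_ext_subproof s))). Qed.

Lemma sh_ext_of (U : opens X) (s : P U) : sh_ext (sh_of s) = c s.
Proof. by apply: (sheaf_stalk_inj hQ) => x Ux; rewrite sh_extE [LHS]stalk_mapE. Qed.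

Lemma sh_ext_res (U V : opens X) (h : V `<=` U) (s : shsec P U) :
  pres Q h (sh_ext s) = sh_ext (shres h s).
Proof.
apply: (sheaf_stalk_inj hQ) => x Vx; rewrite (germ_at_res _ _ (h x Vx)).
by rewrite !sh_extE.
Qed.

End ShExt.

Section RShExt.
Variables (X : topologicalType) (O O' : rpsh X) (hO' : is_sheaf (psh_of_rpsh O')).
Variable c : forall U : opens X, {rmorphism O U -> O' U}.
Hypothesis c_res : forall (U V : opens X) (h : V `<=` U) s,
  rres O' h (c U s) = c V (rres O h s).

Definition rsh_ext (U : opens X) : rshsec O U -> O' U :=
  @sh_ext X (psh_of_rpsh O) (psh_of_rpsh O') hO' c c_res U.

Let cg x (g : stalk (psh_of_rpsh O) x) : rgerms O' [set x] :=
  @stalk_map X (psh_of_rpsh O) (psh_of_rpsh O') c x g.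

Let cgE (U : opens X) x (h : [set x] `<=` U) (s : O U) :
  cg (rgerm h s) = rgerm h (c U s).
Proof. exact: (@stalk_mapE X (psh_of_rpsh O) (psh_of_rpsh O')). Qed.

Let rsh_extE (U : opens X) (s : rshsec O U) x (Ux : U x) :
  rgerm (sub_set1 Ux) (rsh_ext s) = cg (s x Ux).
Proof. exact: sh_extE. Qed.

Lemma rsh_ext_is_additive (U : opens X) : zmod_morphism (@rsh_ext U).
Proof.
move=> s t; apply: (sheaf_stalk_inj hO') => x Ux.
rewrite -[LHS]/(rgerm _ _) -[RHS]/(rgerm _ _) raddfB /= !rsh_extE.
rewrite -[(s - t) x Ux]/((s x Ux : rgerms O _) - (t x Ux : rgerms O _)).
have [V [h [a [b [-> ->]]]]] := germP2 (s x Ux) (t x Ux).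
rewrite -[X in cg (X - _)]/(rgerm h a) -[X in cg (_ - X)]/(rgerm h b).
by rewrite -!/(rgerm h _) -raddfB !cgE !raddfB.
Qed.

Lemma rsh_ext_is_monoid (U : opens X) : monoid_morphism (@rsh_ext U).
Proof.
split=> [|s t]; apply: (sheaf_stalk_inj hO') => x Ux.
  rewrite -[LHS]/(rgerm _ _) -[RHS]/(rgerm _ _) rsh_extE.
  by rewrite -[(1 : rshsec O U) x Ux]/(rgerm (sub_set1 Ux) 1) cgE !rmorph1.
rewrite -[LHS]/(rgerm _ _) -[RHS]/(rgerm _ _) rmorphM /= !rsh_extE.
rewrite -[(s * t) x Ux]/((s x Ux : rgerms O _) * (t x Ux : rgerms O _)).
have [V [h [a [b [-> ->]]]]] := germP2 (s x Ux) (t x Ux).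
by rewrite -!/(rgerm h _) -rmorphM !cgE !rmorphM.
Qed.

HB.instance Definition _ (U : opens X) :=
  GRing.isZmodMorphism.Build (rshsec O U) (O' U) (@rsh_ext U) (@rsh_ext_is_additive U).
HB.instance Definition _ (U : opens X) :=
  GRing.isMonoidMorphism.Build (rshsec O U) (O' U) (@rsh_ext U) (@rsh_ext_is_monoid U).

Lemma rsh_ext_res (U V : opens X) (h : V `<=` U) (s : rshsec O U) :
  rres O' h (rsh_ext s) = rsh_ext (rshres h s).
Proof. exact: (@sh_ext_res X (psh_of_rpsh O) (psh_of_rpsh O') hO' c c_res). Qed.

Lemma rsh_ext_of (U : opens X) (s : O U) : rsh_ext (rsh_of s) = c U s.
Proof. exact: (@sh_ext_of X (psh_of_rpsh O) (psh_of_rpsh O') hO' c c_res). Qed.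

End RShExt.

(** The [L]-module [L (x)_K M], for a [K]-algebra [phi : K -> L] and a
    [K]-module [M]: formal sums of pairs, modulo the relations of the tensor
    product. The opposite of [l (x) m] is [(- l) (x) m]. *)
Section Tensor.
Variables (K L : comPzRingType) (phi : {rmorphism K -> L}) (M : lmodType K).

Inductive tens_eq : seq (L * M) -> seq (L * M) -> Prop :=
| tens_refl s : tens_eq s s
| tens_sym s t : tens_eq s t -> tens_eq t s
| tens_trans s t u : tens_eq s t -> tens_eq t u -> tens_eq s u
| tens_cat s s' t t' : tens_eq s s' -> tens_eq t t' -> tens_eq (s ++ t) (s' ++ t')
| tens_catC s t : tens_eq (s ++ t) (t ++ s)
| tens_0l m : tens_eq [:: (0, m)] [::]
| tens_Dl l l' m : tens_eq [:: (l + l', m)] [:: (l, m); (l', m)]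
| tens_Dr l m m' : tens_eq [:: (l, m + m')] [:: (l, m); (l, m')]
| tens_bal l k m : tens_eq [:: (l * phi k, m)] [:: (l, k *: m)].

Lemma tens_eq_equiv : equivalence_prop tens_eq.
Proof. by split; [exact: tens_refl|exact: tens_sym|exact: tens_trans]. Qed.

Definition tens := cquot tens_eq_equiv.
HB.instance Definition _ := Choice.on tens.

Definition tsum (s : seq (L * M)) : tens := cpi tens_eq_equiv s.
Definition tpure (l : L) (m : M) : tens := tsum [:: (l, m)].

Lemma tsumP (t : tens) : exists s, t = tsum s.
Proof. by exists (crepr t); rewrite [RHS]creprK. Qed.

Definition tens_add (t u : tens) : tens := tsum (crepr t ++ crepr u).
Definition tens_scale (r : L) (t : tens) : tens :=
  tsum [seq (r * p.1, p.2) | p <- crepr t].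
Definition tens_opp (t : tens) : tens := tens_scale (- 1) t.

Lemma tens_addE s t : tens_add (tsum s) (tsum t) = tsum (s ++ t).
Proof. by apply/cpiP; apply: tens_cat; exact: crepr_rel. Qed.

Lemma tens_scale_compat r s t : tens_eq s t ->
  tens_eq [seq (r * p.1, p.2) | p <- s] [seq (r * p.1, p.2) | p <- t].
Proof.
elim=> {s t} /=.
- by move=> s; exact: tens_refl.
- by move=> s t _; exact: tens_sym.
- by move=> s t u _ h _ h'; exact: tens_trans h h'.
- by move=> s s' t t' _ h _ h'; rewrite !map_cat; exact: tens_cat.
- by move=> s t; rewrite !map_cat; exact: tens_catC.
- by move=> m; rewrite mulr0; exact: tens_0l.
- by move=> l l' m; rewrite mulrDr; exact: tens_Dl.
- by move=> l m m'; exact: tens_Dr.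
- by move=> l k m; rewrite mulrA; exact: tens_bal.
Qed.

Lemma tens_scaleE r s :
  tens_scale r (tsum s) = tsum [seq (r * p.1, p.2) | p <- s].
Proof. by apply/cpiP; apply: tens_scale_compat; exact: crepr_rel. Qed.

Lemma tens_addA : associative tens_add.
Proof.
move=> t u v; have [[a ->] [b ->] [c ->]] := And3 (tsumP t) (tsumP u) (tsumP v).
by rewrite !tens_addE catA.
Qed.
Lemma tens_addC : commutative tens_add.
Proof.
move=> t u; have [[a ->] [b ->]] := conj (tsumP t) (tsumP u).
by rewrite !tens_addE; apply/cpiP; exact: tens_catC.
Qed.
Lemma tens_add0 : left_id (tsum [::]) tens_add.
Proof. by move=> t; have [a ->] := tsumP t; rewrite tens_addE. Qed.
Lemma tens_cons p s : tsum (p :: s) = tens_add (tpure p.1 p.2) (tsum s).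
Proof. by case: p => l m; rewrite tens_addE. Qed.
Lemma tpureDl l l' m : tpure (l + l') m = tens_add (tpure l m) (tpure l' m).
Proof. by rewrite tens_addE; apply/cpiP; exact: tens_Dl. Qed.
Lemma tpure0l m : tpure 0 m = tsum [::].
Proof. by apply/cpiP; exact: tens_0l. Qed.
Lemma tens_scaleDl' a b t :
  tens_scale (a + b) t = tens_add (tens_scale a t) (tens_scale b t).
Proof.
have [s ->] := tsumP t; rewrite !tens_scaleE.
elim: s => [|p s IH] /=; first by rewrite tens_addE.
rewrite !tens_cons IH /= mulrDl tpureDl -!tens_addA; congr tens_add.
by rewrite !tens_addA; congr tens_add; exact: tens_addC.
Qed.
Lemma tens_scale0 t : tens_scale 0 t = tsum [::].
Proof.
have [s ->] := tsumP t; rewrite !tens_scaleE.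
by elim: s => [|p s IH] //=; rewrite tens_cons IH /= mul0r tpure0l tens_addE.
Qed.
Lemma tens_scale1 : left_id 1 tens_scale.
Proof.
move=> t; have [s ->] := tsumP t; rewrite tens_scaleE; congr tsum.
by elim: s => [|[l m] s /= ->] //; rewrite mul1r.
Qed.
Lemma tens_addN : left_inverse (tsum [::]) tens_opp tens_add.
Proof.
by move=> t; rewrite -{2}(tens_scale1 t) -tens_scaleDl' addNr tens_scale0.
Qed.

HB.instance Definition _ := GRing.isZmodule.Build tens
  tens_addA tens_addC tens_add0 tens_addN.

Lemma tens_scaleA a b v : tens_scale a (tens_scale b v) = tens_scale (a * b) v.
Proof.
have [s ->] := tsumP v; rewrite !tens_scaleE -map_comp; congr tsum.
by apply: eq_map => p /=; rewrite mulrA.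
Qed.
Lemma tens_scaleDr : right_distributive tens_scale +%R.
Proof.
move=> r t u; have [[a ->] [b ->]] := conj (tsumP t) (tsumP u).
by rewrite [_ + _]tens_addE !tens_scaleE [RHS]tens_addE map_cat.
Qed.
Lemma tens_scaleDl v : {morph tens_scale^~ v : a b / a + b}.
Proof. by move=> a b; exact: tens_scaleDl'. Qed.

HB.instance Definition _ := GRing.Zmodule_isLmodule.Build L tens
  tens_scaleA tens_scale1 tens_scaleDr tens_scaleDl.

Lemma tsum_cat s t : tsum (s ++ t) = tsum s + tsum t.
Proof. by rewrite -tens_addE. Qed.

Lemma tpureZ r l m : r *: tpure l m = tpure (r * l) m.
Proof. exact: tens_scaleE. Qed.

Lemma tpureDr l m m' : tpure l (m + m') = tpure l m + tpure l m'.
Proof. by rewrite -tsum_cat; apply/cpiP; exact: tens_Dr. Qed.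

Lemma tpure_bal l k m : tpure (l * phi k) m = tpure l (k *: m).
Proof. by apply/cpiP; exact: tens_bal. Qed.

Lemma tsumE s : tsum s = \sum_(p <- s) tpure p.1 p.2.
Proof.
elim: s => [|p s IH]; first by rewrite big_nil.
by rewrite big_cons -IH tens_cons.
Qed.

Section Lift.
Variables (G : zmodType) (b : L -> M -> G).
Hypotheses (bDl : forall l l' m, b (l + l') m = b l m + b l' m)
  (bDr : forall l m m', b l (m + m') = b l m + b l m')
  (b_bal : forall l k m, b (l * phi k) m = b l (k *: m)).

Definition tens_lift (t : tens) : G := \sum_(p <- crepr t) b p.1 p.2.

Lemma tens_lift_sum s : tens_lift (tsum s) = \sum_(p <- s) b p.1 p.2.
Proof.
have b0 m : b 0 m = 0 by apply: (addrI (b 0 m)); rewrite -bDl !addr0.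
rewrite /tens_lift; have := crepr_rel tens_eq_equiv s; rewrite -/(tsum s).
move: (crepr (tsum s)) => s'; elim=> {s s'} //=.
- by move=> s t u _ -> _ ->.
- by move=> s s' t t' _ h _ h'; rewrite !big_cat /= h h'.
- by move=> s t; rewrite !big_cat /= addrC.
- by move=> m; rewrite big_seq1 big_nil /= b0.
- by move=> l l' m; rewrite !big_cons !big_nil /= !addr0 bDl.
- by move=> l m m'; rewrite !big_cons !big_nil /= !addr0 bDr.
- by move=> l k m; rewrite !big_seq1 /= b_bal.
Qed.

Lemma tens_lift_is_additive : zmod_morphism tens_lift.
Proof.
have liftD t u : tens_lift (t + u) = tens_lift t + tens_lift u.
  have [[x ->] [y ->]] := conj (tsumP t) (tsumP u).
  by rewrite -tsum_cat !tens_lift_sum big_cat.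
by move=> t u; apply: (addIr (tens_lift u)); rewrite -liftD !subrK.
Qed.

Lemma tens_lift_pure l m : tens_lift (tpure l m) = b l m.
Proof. by rewrite tens_lift_sum big_seq1. Qed.
End Lift.

Lemma tens_ind (Q : tens -> Prop) :
  Q 0 -> (forall t u, Q t -> Q u -> Q (t + u)) -> (forall l m, Q (tpure l m)) ->
  forall t, Q t.
Proof.
move=> Q0 QD Qp t; have [s ->] := tsumP t; rewrite tsumE.
by elim: s => [|p s IH]; [rewrite big_nil|rewrite big_cons; exact: QD].
Qed.

End Tensor.

Section TensorMap.
Variables (K L : comPzRingType) (phi : {rmorphism K -> L}) (M : lmodType K).
Variables (K' L' : comPzRingType) (phi' : {rmorphism K' -> L'}) (M' : lmodType K').
Variables (u : {rmorphism K -> K'}) (v : {rmorphism L -> L'}) (w : {additive M -> M'}).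
Hypothesis uv : forall k, v (phi k) = phi' (u k).
Hypothesis uw : forall k m, w (k *: m) = u k *: w m.

Definition tens_map : tens phi M -> tens phi' M' :=
  tens_lift (fun l m => tpure phi' (v l) (w m)).

Let bDl l l' m : tpure phi' (v (l + l')) (w m) =
  tpure phi' (v l) (w m) + tpure phi' (v l') (w m).
Proof. by rewrite raddfD; exact: tpureDl. Qed.
Let bDr l m m' : tpure phi' (v l) (w (m + m')) =
  tpure phi' (v l) (w m) + tpure phi' (v l) (w m').
Proof. by rewrite raddfD; exact: tpureDr. Qed.
Let b_bal l k m : tpure phi' (v (l * phi k)) (w m) = tpure phi' (v l) (w (k *: m)).
Proof. by rewrite rmorphM uv uw tpure_bal. Qed.

Lemma tens_map_is_additive : zmod_morphism tens_map.
Proof. exact: tens_lift_is_additive bDl bDr b_bal. Qed.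

Lemma tens_map_pure l m : tens_map (tpure phi l m) = tpure phi' (v l) (w m).
Proof. exact: (tens_lift_pure bDl bDr b_bal). Qed.
End TensorMap.

Definition restr_sc (K L : comPzRingType) (phi : {rmorphism K -> L})
  (M : lmodType L) : Type := M.

Section RestrictScalars.
Variables (K L : comPzRingType) (phi : {rmorphism K -> L}) (M : lmodType L).

HB.instance Definition _ := GRing.Zmodule.copy (restr_sc phi M) M.

Definition restr_scale (k : K) (m : restr_sc phi M) : restr_sc phi M := phi k *: (m : M).
Lemma restr_scaleA a b v : restr_scale a (restr_scale b v) = restr_scale (a * b) v.
Proof. by rewrite /restr_scale scalerA rmorphM. Qed.
Lemma restr_scale1 : left_id 1 restr_scale.
Proof. by move=> v; rewrite /restr_scale rmorph1 scale1r. Qed.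
Lemma restr_scaleDr : right_distributive restr_scale +%R.
Proof. by move=> k v w; rewrite /restr_scale scalerDr. Qed.
Lemma restr_scaleDl v : {morph restr_scale^~ v : a b / a + b}.
Proof. by move=> a b; rewrite /restr_scale rmorphD scalerDl. Qed.
HB.instance Definition _ := GRing.Zmodule_isLmodule.Build K (restr_sc phi M)
  restr_scaleA restr_scale1 restr_scaleDr restr_scaleDl.
End RestrictScalars.

Section RestrictScalarsPsh.
Variables (X : topologicalType) (O O' : rpsh X).
Variable phi : forall U : opens X, {rmorphism O U -> O' U}.
Hypothesis phi_res : forall (U V : opens X) (h : V `<=` U) s,
  rres O' h (phi U s) = phi V (rres O h s).
Variable M : mpsh O'.

Definition restr_res (U V : opens X) (h : V `<=` U) :
  {additive restr_sc (phi U) (M U) -> restr_sc (phi V) (M V)} := mres M h.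

Lemma restr_res_scale (U V : opens X) (h : V `<=` U) (r : O U)
    (s : restr_sc (phi U) (M U)) :
  restr_res h (r *: s) = rres O h r *: restr_res h s.
Proof. by rewrite [LHS](@mres_scale _ _ M _ _ h) phi_res. Qed.

Definition restr_mpsh : mpsh O :=
  @MPsh X O (fun U => restr_sc (phi U) (M U)) restr_res restr_res_scale
    (@mres_id X O' M) (@mres_comp X O' M).
End RestrictScalarsPsh.

(** Morphisms of ringed spaces [(Y, OY) -> (X, OX)]. *)
Record rmap (X Y : topologicalType) (OX : rpsh X) (OY : rpsh Y) := RMap {
  rmap_fun :> Y -> X;
  rmap_cont : continuous rmap_fun;
  rmap_sharp : forall U : opens X,
    {rmorphism OX U -> OY (opens_preimage rmap_cont U)};
  rmap_res : forall (U V : opens X) (h : V `<=` U)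
    (h' : opens_preimage rmap_cont V `<=` opens_preimage rmap_cont U) (s : OX U),
    rmap_sharp V (rres OX h s) = rres OY h' (rmap_sharp U s) }.

Section RMapTheory.
Variables (X Y : topologicalType) (OX : rpsh X) (OY : rpsh Y) (f : rmap OX OY).

Definition preimo (U : opens X) : opens Y := opens_preimage (@rmap_cont _ _ _ _ f) U.

Lemma preimoS (U V : opens X) : V `<=` U -> preimo V `<=` preimo U.
Proof. by move=> h y; exact: h. Qed.

Lemma sub_preimo (W : set Y) (U : opens X) : f @` W `<=` U -> W `<=` preimo U.
Proof. by move=> h y Wy; apply: h; exists y. Qed.

Lemma sub_image (W : set Y) (U : opens X) : W `<=` preimo U -> f @` W `<=` U.
Proof. by move=> h _ [y Wy <-]; exact: h. Qed.

Definition rmap_stalk (y : Y) (g : rgerms OX [set f y]) : rgerms OY [set y] :=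
  germ_lift (P := psh_of_rpsh OX) (fun (U : opens X) (h : [set f y] `<=` U) s =>
    rgerm (U := preimo U) (@sub_set1 _ y (preimo U) (h (f y) erefl))
      (rmap_sharp f U s)) g.

Section Pushforward.
Variable B : mpsh OY.

Definition pushf_res (U V : opens X) (h : V `<=` U) :
  {additive restr_sc (rmap_sharp f U) (B (preimo U)) ->
            restr_sc (rmap_sharp f V) (B (preimo V))} := mres B (preimoS h).

Lemma pushf_scale (U V : opens X) (h : V `<=` U) (r : OX U)
    (s : restr_sc (rmap_sharp f U) (B (preimo U))) :
  pushf_res h (r *: s) = rres OX h r *: pushf_res h s.
Proof.
by rewrite [LHS](@mres_scale _ _ B _ _ (preimoS h)) -(rmap_res h).
Qed.

Definition pushforward : mpsh OX :=
  @MPsh X OX (fun U => restr_sc (rmap_sharp f U) (B (preimo U))) pushf_res pushf_scale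
    (fun U h => @mres_id _ _ B _ (preimoS h))
    (fun U V W h1 h2 h => @mres_comp _ _ B _ _ _ (preimoS h1) (preimoS h2) (preimoS h)).
End Pushforward.

End RMapTheory.

(** The inverse image [f^-1 P] is the sheaf associated to the presheaf sending
    [V] to the colimit [germs P (f @` V)]. *)
Section InverseImage.
Variables (X Y : topologicalType) (f : Y -> X).

Section Presheaf.
Variable P : psh X.

Definition germ_restr (S T : set X) (h : T `<=` S) (g : germs P S) : germs P T :=
  germ_lift (fun (U : opens X) (k : S `<=` U) s => germ (subset_trans h k) s) g.

Lemma germ_restrE (S T : set X) (h : T `<=` S) (U : opens X) (k : S `<=` U)
    (l : T `<=` U) (s : P U) :
  germ_restr h (germ k s) = germ l s.
Proof.
rewrite /germ_restr germ_liftE; first exact: germ_irr.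
by move=> {U k l s} U V k l VU s; exact: germ_res.
Qed.

Lemma germ_restr_is_additive (S T : set X) (h : T `<=` S) :
  zmod_morphism (germ_restr h).
Proof.
move=> g g'; have [U [k [s [s' [-> ->]]]]] := germP2 g g'.
by rewrite -raddfB !(germ_restrE _ _ (subset_trans h k)) -raddfB.
Qed.
HB.instance Definition _ (S T : set X) (h : T `<=` S) :=
  GRing.isZmodMorphism.Build (germs P S) (germs P T) (germ_restr h)
    (germ_restr_is_additive h).

Lemma germ_restr_id (S : set X) (h : S `<=` S) g : germ_restr h g = g.
Proof. by have [U [k [s ->]]] := germP g; rewrite (germ_restrE _ _ k). Qed.

Lemma germ_restr_comp (S T T' : set X) (h1 : T `<=` S) (h2 : T' `<=` T)
    (h : T' `<=` S) g : germ_restr h2 (germ_restr h1 g) = germ_restr h g.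
Proof.
have [U [k [s ->]]] := germP g.
rewrite (germ_restrE _ _ (subset_trans h1 k)).
by rewrite !(germ_restrE _ _ (subset_trans h k)).
Qed.

Lemma imageS (V W : opens Y) : W `<=` V -> f @` W `<=` f @` V.
Proof. exact: image_subset. Qed.

End Presheaf.

Section Ring.
Variable O : rpsh X.
Notation OP := (psh_of_rpsh O).

Definition rgerm_restr (S T : set X) (h : T `<=` S) : rgerms O S -> rgerms O T :=
  germ_restr (P := OP) h.

Lemma rgerm_restrE (S T : set X) (h : T `<=` S) (U : opens X) (k : S `<=` U)
    (l : T `<=` U) (s : O U) :
  rgerm_restr h (rgerm k s) = rgerm l s.
Proof. exact: (germ_restrE (P := OP)). Qed.

Lemma rgerm_restr_is_additive (S T : set X) (h : T `<=` S) :
  zmod_morphism (rgerm_restr h).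
Proof. exact: (germ_restr_is_additive (P := OP)). Qed.
Lemma rgerm_restr_is_monoid (S T : set X) (h : T `<=` S) :
  monoid_morphism (rgerm_restr h).
Proof.
split=> [|g g'].
  have k : S `<=` opensT X by [].
  by rewrite -(rmorph1 (rgerm k)) (rgerm_restrE _ _ (subset_trans h k)) rmorph1.
have [U [k [s [s' [-> ->]]]]] := germP2 g g'; rewrite -!/(rgerm k _).
by rewrite -rmorphM !(rgerm_restrE _ _ (subset_trans h k)) rmorphM.
Qed.
HB.instance Definition _ (S T : set X) (h : T `<=` S) :=
  GRing.isZmodMorphism.Build (rgerms O S) (rgerms O T) (rgerm_restr h)
    (rgerm_restr_is_additive h).
HB.instance Definition _ (S T : set X) (h : T `<=` S) :=
  GRing.isMonoidMorphism.Build (rgerms O S) (rgerms O T) (rgerm_restr h)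
    (rgerm_restr_is_monoid h).

Definition rinv_psh : rpsh Y :=
  @RPsh Y (fun V => rgerms O (f @` V)) (fun V W h => rgerm_restr (imageS h))
    (fun V h => @germ_restr_id OP _ (imageS h))
    (fun V W Z h1 h2 h =>
      @germ_restr_comp OP _ _ _ (imageS h1) (imageS h2) (imageS h)).

Definition rinv : rpsh Y := rsheafify rinv_psh.
End Ring.

Section Mod.
Variables (O : rpsh X) (M : mpsh O).
Notation MP := (psh_of_mpsh M).

Definition mgerm_restr (S T : set X) (h : T `<=` S) : mgerms M S -> mgerms M T :=
  germ_restr (P := MP) h.

Lemma mgerm_restrE (S T : set X) (h : T `<=` S) (U : opens X) (k : S `<=` U)
    (l : T `<=` U) (s : M U) :
  mgerm_restr h (mgerm k s) = mgerm l s.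
Proof. exact: (germ_restrE (P := MP)). Qed.

Lemma mgerm_restr_is_additive (S T : set X) (h : T `<=` S) :
  zmod_morphism (mgerm_restr h).
Proof. exact: (germ_restr_is_additive (P := MP)). Qed.
HB.instance Definition _ (S T : set X) (h : T `<=` S) :=
  GRing.isZmodMorphism.Build (mgerms M S) (mgerms M T) (mgerm_restr h)
    (mgerm_restr_is_additive h).

Lemma mgerm_restr_scale (S T : set X) (h : T `<=` S) (r : rgerms O S) (g : mgerms M S) :
  mgerm_restr h (r *: g) = rgerm_restr h r *: mgerm_restr h g.
Proof.
have [U [k [a [s [-> ->]]]]] := germP2 r g; rewrite -!/(rgerm k _) -!/(mgerm k _).
rewrite -mgerm_scale !(mgerm_restrE _ _ (subset_trans h k)).
by rewrite (rgerm_restrE _ _ (subset_trans h k)) mgerm_scale.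
Qed.

Definition minv_psh : mpsh (rinv_psh O) :=
  @MPsh Y (rinv_psh O) (fun V => mgerms M (f @` V))
    (fun V W h => mgerm_restr (imageS h))
    (fun V W h => @mgerm_restr_scale _ _ (imageS h))
    (fun V h => @germ_restr_id MP _ (imageS h))
    (fun V W Z h1 h2 h =>
      @germ_restr_comp MP _ _ _ (imageS h1) (imageS h2) (imageS h)).

Definition minv : mpsh (rinv O) := msheafify minv_psh.
End Mod.
End InverseImage.

Definition rsh_unit (X : topologicalType) (O : rpsh X) (U : opens X) :
  {rmorphism O U -> rsheafify O U} := @rsh_of X O U.

Section Pullback.
Variables (X Y : topologicalType) (OX : rpsh X) (OY : rpsh Y).
Variables (hOY : is_sheaf (psh_of_rpsh OY)) (f : rmap OX OY).

Definition rinv_psh_sharp (V : opens Y) : rinv_psh f OX V -> OY V :=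
  germ_lift (P := psh_of_rpsh OX) (fun (U : opens X) (h : f @` V `<=` U) s =>
    rres OY (sub_preimo h : V `<=` preimo f U) (rmap_sharp f U s)).

Lemma rinv_psh_sharpE (V : opens Y) (U : opens X) (h : f @` V `<=` U)
    (k : V `<=` preimo f U) (s : OX U) :
  rinv_psh_sharp (rgerm h s) = rres OY k (rmap_sharp f U s).
Proof.
rewrite /rinv_psh_sharp /rgerm germ_liftE; first by rewrite (Prop_irrelevance (sub_preimo h) k).
move=> {U h k s} U W h k WU s.
by rewrite /= (rmap_res WU (preimoS WU)) (rres_comp _ _ (sub_preimo h)).
Qed.

Lemma rinv_psh_sharp_is_additive (V : opens Y) : zmod_morphism (@rinv_psh_sharp V).
Proof.
move=> g g'; have [U [h [s [s' [-> ->]]]]] := germP2 g g'; rewrite -!/(rgerm h _).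
by rewrite -raddfB !(rinv_psh_sharpE _ (sub_preimo h)) !raddfB.
Qed.
Lemma rinv_psh_sharp_is_monoid (V : opens Y) : monoid_morphism (@rinv_psh_sharp V).
Proof.
split=> [|g g'].
  have h : f @` V `<=` opensT X by [].
  by rewrite -(rmorph1 (rgerm h)) (rinv_psh_sharpE _ (sub_preimo h)) !rmorph1.
have [U [h [s [s' [-> ->]]]]] := germP2 g g'; rewrite -!/(rgerm h _).
by rewrite -rmorphM !(rinv_psh_sharpE _ (sub_preimo h)) !rmorphM.
Qed.
HB.instance Definition _ (V : opens Y) :=
  GRing.isZmodMorphism.Build (rinv_psh f OX V) (OY V) (@rinv_psh_sharp V)
    (@rinv_psh_sharp_is_additive V).
HB.instance Definition _ (V : opens Y) :=
  GRing.isMonoidMorphism.Build (rinv_psh f OX V) (OY V) (@rinv_psh_sharp V)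
    (@rinv_psh_sharp_is_monoid V).

Lemma rinv_psh_sharp_res (V W : opens Y) (h : W `<=` V) (g : rinv_psh f OX V) :
  rres OY h (rinv_psh_sharp g) = rinv_psh_sharp (rres (rinv_psh f OX) h g).
Proof.
have [U [k [s ->]]] := germP g; rewrite -!/(rgerm k _).
pose l := subset_trans (imageS h) k.
rewrite [rres (rinv_psh f OX) h _](rgerm_restrE _ _ l) (rinv_psh_sharpE _ (sub_preimo k)).
by rewrite (rres_comp _ _ (sub_preimo l)) (rinv_psh_sharpE _ (sub_preimo l)).
Qed.

Definition rinv_sharp (V : opens Y) : {rmorphism rinv f OX V -> OY V} :=
  rsh_ext hOY (c := fun V => @rinv_psh_sharp V) rinv_psh_sharp_res (U := V).

Lemma rinv_sharp_res (V W : opens Y) (h : W `<=` V) (s : rinv f OX V) :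
  rres OY h (rinv_sharp V s) = rinv_sharp W (rres (rinv f OX) h s).
Proof. exact: rsh_ext_res. Qed.

Variable A : mpsh OX.

Definition tens_res (V W : opens Y) (h : W `<=` V) :
    tens (rinv_sharp V) (minv f A V) -> tens (rinv_sharp W) (minv f A W) :=
  tens_map (rinv_sharp W) (rres OY h) (mres (minv f A) h).

Lemma tens_res_pure (V W : opens Y) (h : W `<=` V) l m :
  tens_res h (tpure _ l m) = tpure _ (rres OY h l) (mres (minv f A) h m).
Proof.
apply: (tens_map_pure (u := rres (rinv f OX) h)) => [k|k a].
  exact: rinv_sharp_res.
exact: mres_scale.
Qed.

Lemma tens_res_is_additive (V W : opens Y) (h : W `<=` V) :
  zmod_morphism (tens_res h).
Proof.
apply: (tens_map_is_additive (u := rres (rinv f OX) h)) => [k|k a].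
  exact: rinv_sharp_res.
exact: mres_scale.
Qed.
HB.instance Definition _ (V W : opens Y) (h : W `<=` V) :=
  GRing.isZmodMorphism.Build _ _ (tens_res h) (tens_res_is_additive h).

Lemma tens_res_scale (V W : opens Y) (h : W `<=` V) (r : OY V) t :
  tens_res h (r *: t) = rres OY h r *: tens_res h t.
Proof.
elim/tens_ind: t => [|t u ht hu|l m].
- by rewrite (scaler0 _ r) raddf0 [RHS](scaler0 _ (rres OY h r)).
- rewrite (scalerDr r) !(raddfD (tens_res h)) /= ht hu.
  by rewrite [RHS](scalerDr (rres OY h r)).
- by rewrite tpureZ !tens_res_pure [RHS]tpureZ rmorphM.
Qed.

Lemma tens_res_id (V : opens Y) (h : V `<=` V) t : tens_res h t = t.
Proof.
elim/tens_ind: t => [|t u ht hu|l m]; first by rewrite raddf0.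
  by rewrite raddfD /= ht hu.
by rewrite tens_res_pure rres_id mres_id.
Qed.

Lemma tens_res_comp (V W Z : opens Y) (h1 : W `<=` V) (h2 : Z `<=` W)
  (h : Z `<=` V) t : tens_res h2 (tens_res h1 t) = tens_res h t.
Proof.
elim/tens_ind: t => [|t u ht hu|l m]; first by rewrite !raddf0.
  by rewrite !raddfD /= ht hu.
by rewrite !tens_res_pure (rres_comp _ _ h) (mres_comp _ _ h).
Qed.

Definition tens_psh : mpsh OY :=
  @MPsh Y OY (fun V => tens (rinv_sharp V) (minv f A V))
    (fun V W h => tens_res h) tens_res_scale tens_res_id tens_res_comp.

Lemma rsh_of_res (V W : opens Y) (h : W `<=` V) (s : OY V) :
  rres (rsheafify OY) h (rsh_unit OY V s) = rsh_unit OY W (rres OY h s).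
Proof. by symmetry; exact: (sh_of_res (P := psh_of_rpsh OY)). Qed.

(** The pullback [OY (x) f^-1 A] over [f^-1 OX]: the sheaf associated to the
    presheaf of tensor products. Sheafification produces a module over the
    sheafification of [OY], which is viewed as a module over [OY]. *)
Definition pullback_mpsh : mpsh OY :=
  restr_mpsh (phi := rsh_unit OY) rsh_of_res (msheafify tens_psh).

Lemma pullback_is_sheaf : is_sheaf (psh_of_mpsh pullback_mpsh).
Proof. exact: (@sheafify_is_sheaf Y (psh_of_mpsh tens_psh)). Qed.

(** The local section [s (x) a] of the pullback over [V], for [s] a section of
    [OY] over [V] and [a] a section of [A] over [U], where [f @` V `<=` U]. *)
Definition pb_tensor (U : opens X) (V : opens Y) (h : V `<=` preimo f U)
    (s : OY V) (a : A U) : pullback_mpsh V :=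
  msh_of (M := tens_psh)
    (tpure (rinv_sharp V) s
      (msh_of (M := minv_psh f A) (mgerm (sub_image h) a))).

Lemma pb_tensor_bal (U : opens X) (V : opens Y) (h : V `<=` preimo f U)
    (s : OY V) (r : OX U) (a : A U) :
  pb_tensor h s (r *: a) = pb_tensor h (s * rres OY h (rmap_sharp f U r)) a.
Proof.
congr msh_of; rewrite mgerm_scale.
rewrite [msh_of _](@msh_of_scale Y (rinv_psh f OX) (minv_psh f A)) -tpure_bal.
congr (tpure _ (_ * _)); rewrite [LHS]rsh_ext_of.
exact: rinv_psh_sharpE.
Qed.

Lemma pb_tensorDr (U : opens X) (V : opens Y) (h : V `<=` preimo f U)
    (s : OY V) (a b : A U) :
  pb_tensor h s (a + b) = pb_tensor h s a + pb_tensor h s b.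
Proof.
rewrite /pb_tensor -mgerm_add.
rewrite [X in tpure _ s X](raddfD (@sh_of Y (psh_of_mpsh (minv_psh f A)) V)).
rewrite tpureDr.
exact: (raddfD (@sh_of Y (psh_of_mpsh tens_psh) V)).
Qed.

Lemma pb_tensorZ (U : opens X) (V : opens Y) (h : V `<=` preimo f U)
    (r s : OY V) (a : A U) :
  r *: pb_tensor h s a = pb_tensor h (r * s) a.
Proof. by rewrite /pb_tensor -tpureZ msh_of_scale. Qed.

Lemma pb_tensor_res (U U' : opens X) (V V' : opens Y) (h : V `<=` preimo f U)
    (h' : V' `<=` preimo f U') (k : V' `<=` V) (l : U' `<=` U) (s : OY V) (a : A U) :
  mres pullback_mpsh k (pb_tensor h s a) = pb_tensor h' (rres OY k s) (mres A l a).
Proof.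
rewrite [LHS](esym (@sh_of_res Y (psh_of_mpsh tens_psh) _ _ k _)).
congr msh_of; rewrite [LHS]tens_res_pure; congr tpure.
rewrite [LHS](esym (@sh_of_res Y (psh_of_mpsh (minv_psh f A)) _ _ k _)).
congr msh_of; rewrite [LHS](mgerm_restrE _ _ (subset_trans (sub_image h') l)).
by symmetry; exact: germ_res.
Qed.

End Pullback.

Record mmor (X : topologicalType) (O : rpsh X) (M N : mpsh O) := MMor {
  mmor_fun :> forall U : opens X, M U -> N U;
  mmor_linear : forall U : opens X, linear (@mmor_fun U);
  mmor_res : forall (U V : opens X) (h : V `<=` U) (s : M U),
    mmor_fun (mres M h s) = mres N h (mmor_fun s) }.

Lemma mmor_eq (X : topologicalType) (O : rpsh X) (M N : mpsh O) (F G : mmor M N) :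
  (forall (U : opens X) (s : M U), F U s = G U s) -> F = G.
Proof.
case: F G => [F lF rF] [G lG rG] /= FG.
have {}FG : F = G by apply: functional_extensionality_dep => U; exact: funext.
by subst G; congr MMor; exact: Prop_irrelevance.
Qed.

Program Definition mcomp (X : topologicalType) (O : rpsh X) (M N Q : mpsh O)
    (G : mmor N Q) (F : mmor M N) : mmor M Q :=
  @MMor X O M Q (fun U s => G U (F U s)) _ _.
Next Obligation. by move=> X O M N Q G F U r s t; rewrite !mmor_linear. Qed.
Next Obligation. by move=> X O M N Q G F U V h s /=; rewrite (mmor_res F) (mmor_res G). Qed.

Program Definition pushf_mmor (X Y : topologicalType) (OX : rpsh X) (OY : rpsh Y)
    (f : rmap OX OY) (M N : mpsh OY) (F : mmor M N) :
    mmor (pushforward f M) (pushforward f N) :=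
  @MMor X OX (pushforward f M) (pushforward f N) (fun U s => F (preimo f U) s) _ _.
Next Obligation. by move=> X Y OX OY f M N F U r s t; exact: (mmor_linear F (rmap_sharp f U r)). Qed.
Next Obligation. by move=> X Y OX OY f M N F U V h s; exact: (mmor_res F). Qed.

Record smod (X : topologicalType) (O : rpsh X) := SMod {
  smod_mpsh :> mpsh O;
  smod_is_sheaf : is_sheaf (psh_of_mpsh smod_mpsh) }.

Section LocalRing.
Implicit Types A B : comPzRingType.

Definition is_ideal A (I : set A) : Prop :=
  [/\ I 0, (forall x y, I x -> I y -> I (x + y)) & forall a x, I x -> I (a * x)].

Definition maximal_ideal A (m : set A) : Prop :=
  [/\ is_ideal m, m <> setT &
      forall J : set A, is_ideal J -> J <> setT -> m `<=` J -> J = m].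

Definition local_ring A : Prop := exists! m : set A, maximal_ideal m.

Definition local_hom A B (phi : A -> B) : Prop :=
  forall (m : set A) (n : set B),
    maximal_ideal m -> maximal_ideal n -> phi @` m `<=` n.
End LocalRing.

(** Locally ringed spaces over [R]. Mathcomp's algebra structures require
    [1 != 0], which fails for the sections over the empty set: the [R]-algebra
    structure on sections is given by ring morphisms from [R]. *)
Record lrs (R : realType) := LRS {
  lrs_space :> topologicalType;
  lrs_O : rpsh lrs_space;
  lrs_is_sheaf : is_sheaf (psh_of_rpsh lrs_O);
  lrs_cst : forall U : opens lrs_space, {rmorphism R -> lrs_O U};
  lrs_cst_res : forall (U V : opens lrs_space) (h : V `<=` U) (c : R),
    rres lrs_O h (lrs_cst U c) = lrs_cst V c;
  lrs_local : forall x : lrs_space, local_ring (rgerms lrs_O [set x]) }.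

Arguments lrs_is_sheaf {R} l.

Record lrs_mor (R : realType) (Y X : lrs R) := LRSMor {
  lrs_rmap :> rmap (lrs_O X) (lrs_O Y);
  lrs_mor_cst : forall (U : opens X) (c : R),
    rmap_sharp lrs_rmap U (lrs_cst U c) = lrs_cst _ c;
  lrs_mor_local : forall y : Y, local_hom (@rmap_stalk _ _ _ _ lrs_rmap y) }.

(** The sheaf [Der(O_X)]: its sections over [U] are the [R]-linear derivations
    of the restriction of [O_X] to [U]. *)
Section Der.
Variables (R : realType) (X : lrs R).
Notation O := (lrs_O X).

Record der (U : opens X) := Der {
  der_fun :> forall V : opens X, V `<=` U -> O V -> O V;
  der_add : forall (V : opens X) (h : V `<=` U) r s,
    der_fun h (r + s) = der_fun h r + der_fun h s;
  der_cst : forall (V : opens X) (h : V `<=` U) (c : R) r,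
    der_fun h (lrs_cst V c * r) = lrs_cst V c * der_fun h r;
  der_leibniz : forall (V : opens X) (h : V `<=` U) r s,
    der_fun h (r * s) = der_fun h r * s + r * der_fun h s;
  der_res : forall (V W : opens X) (h : V `<=` U) (k : W `<=` V) (l : W `<=` U) r,
    rres O k (der_fun h r) = der_fun l (rres O k r) }.

Lemma der_eq U (D E : der U) :
  (forall (V : opens X) (h : V `<=` U) r, D V h r = E V h r) -> D = E.
Proof.
case: D E => [D d1 d2 d3 d4] [E e1 e2 e3 e4] /= DE.
have {}DE : D = E.
  apply: functional_extensionality_dep => V.
  by apply: functional_extensionality_dep => h; apply: funext => r.
by subst E; congr Der; exact: Prop_irrelevance.
Qed.

HB.instance Definition _ U := gen_eqMixin (der U).
HB.instance Definition _ U := gen_choiceMixin (der U).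

Section Ops.
Variable U : opens X.
Implicit Types D E : der U.

Program Definition der0 : der U := @Der U (fun V h r => 0) _ _ _ _.
Next Obligation. by move=> * /=; rewrite addr0. Qed.
Next Obligation. by move=> * /=; rewrite mulr0. Qed.
Next Obligation. by move=> * /=; rewrite mul0r mulr0 addr0. Qed.
Next Obligation. by move=> * /=; rewrite rmorph0. Qed.

Program Definition der_opp D : der U := @Der U (fun V h r => - D V h r) _ _ _ _.
Next Obligation. by move=> D V h r s /=; rewrite der_add opprD. Qed.
Next Obligation. by move=> D V h c r /=; rewrite der_cst mulrN. Qed.
Next Obligation. by move=> D V h r s /=; rewrite der_leibniz opprD mulNr mulrN. Qed.
Next Obligation. by move=> D V W h k l r /=; rewrite rmorphN (der_res _ h k l). Qed.

Program Definition der_plus D E : der U :=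
  @Der U (fun V h r => D V h r + E V h r) _ _ _ _.
Next Obligation. by move=> D E V h r s /=; rewrite !der_add addrACA. Qed.
Next Obligation. by move=> D E V h c r /=; rewrite !der_cst mulrDr. Qed.
Next Obligation.
by move=> D E V h r s /=; rewrite !der_leibniz mulrDl mulrDr addrACA.
Qed.
Next Obligation. by move=> D E V W h k l r /=; rewrite rmorphD !(der_res _ h k l). Qed.

Program Definition der_scale (u : O U) D : der U :=
  @Der U (fun V h r => rres O h u * D V h r) _ _ _ _.
Next Obligation. by move=> u D V h r s /=; rewrite der_add mulrDr. Qed.
Next Obligation. by move=> u D V h c r /=; rewrite der_cst mulrCA. Qed.
Next Obligation.
by move=> u D V h r s /=; rewrite der_leibniz mulrDr mulrA [in X in _ + X]mulrCA.
Qed.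
Next Obligation.
by move=> u D V W h k l r /=; rewrite rmorphM (der_res _ h k l) (rres_comp _ _ l).
Qed.

Program Definition der_brk D E : der U :=
  @Der U (fun V h r => D V h (E V h r) - E V h (D V h r)) _ _ _ _.
Next Obligation.
by move=> D E V h r s /=; rewrite !der_add opprD addrACA.
Qed.
Next Obligation. by move=> D E V h c r /=; rewrite !der_cst mulrBr. Qed.
Next Obligation.
by move=> D E V h r s /=; rewrite !(der_leibniz, der_add); ring. Qed.
Next Obligation.
by move=> D E V W h k l r /=; rewrite rmorphB !(der_res _ h k l).
Qed.

Lemma der_addA : associative der_plus.
Proof. by move=> *; apply: der_eq => * /=; rewrite addrA. Qed.
Lemma der_addC : commutative der_plus.
Proof. by move=> *; apply: der_eq => * /=; rewrite addrC. Qed.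
Lemma der_add0 : left_id der0 der_plus.
Proof. by move=> *; apply: der_eq => * /=; rewrite add0r. Qed.
Lemma der_addN : left_inverse der0 der_opp der_plus.
Proof. by move=> *; apply: der_eq => * /=; rewrite addNr. Qed.
HB.instance Definition _ := GRing.isZmodule.Build (der U)
  der_addA der_addC der_add0 der_addN.

Lemma der_scaleA a b D : der_scale a (der_scale b D) = der_scale (a * b) D.
Proof. by apply: der_eq => * /=; rewrite rmorphM mulrA. Qed.
Lemma der_scale1 : left_id 1 der_scale.
Proof. by move=> *; apply: der_eq => * /=; rewrite rmorph1 mul1r. Qed.
Lemma der_scaleDr : right_distributive der_scale +%R.
Proof. by move=> *; apply: der_eq => * /=; rewrite mulrDr. Qed.
Lemma der_scaleDl D : {morph der_scale^~ D : a b / a + b}.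
Proof. by move=> *; apply: der_eq => * /=; rewrite rmorphD mulrDl. Qed.
HB.instance Definition _ := GRing.Zmodule_isLmodule.Build (O U) (der U)
  der_scaleA der_scale1 der_scaleDr der_scaleDl.
End Ops.

Program Definition der_restr (U V : opens X) (h : V `<=` U) (D : der U) : der V :=
  @Der V (fun W k r => D W (subset_trans k h) r) _ _ _ _.
Next Obligation. by move=> U V h D W k r s /=; rewrite der_add. Qed.
Next Obligation. by move=> U V h D W k c r /=; rewrite der_cst. Qed.
Next Obligation. by move=> U V h D W k r s /=; rewrite der_leibniz. Qed.
Next Obligation. by move=> U V h D W Z k l m r /=; exact: der_res. Qed.

Lemma der_restr_is_additive (U V : opens X) (h : V `<=` U) :
  zmod_morphism (der_restr h).
Proof. by move=> D E; apply: der_eq. Qed.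
HB.instance Definition _ (U V : opens X) (h : V `<=` U) :=
  GRing.isZmodMorphism.Build (der U) (der V) (der_restr h) (der_restr_is_additive h).

Lemma der_restr_scale (U V : opens X) (h : V `<=` U) (r : O U) (D : der U) :
  der_restr h (r *: D) = rres O h r *: der_restr h D.
Proof. by apply: der_eq => W k s /=; rewrite (rres_comp _ _ (subset_trans k h)). Qed.

Lemma der_fun_irr (U V : opens X) (h k : V `<=` U) (D : der U) r : D V h r = D V k r.
Proof. by rewrite (Prop_irrelevance h k). Qed.

Lemma der_restr_id (U : opens X) (h : U `<=` U) (D : der U) : der_restr h D = D.
Proof. by apply: der_eq => W k s /=; exact: der_fun_irr. Qed.
Lemma der_restr_comp (U V W : opens X) (h1 : V `<=` U) (h2 : W `<=` V)
  (h : W `<=` U) (D : der U) : der_restr h2 (der_restr h1 D) = der_restr h D.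
Proof. by apply: der_eq => Z k s /=; exact: der_fun_irr. Qed.

Definition der_mpsh : mpsh O :=
  @MPsh X O der (fun U V h => der_restr h) der_restr_scale der_restr_id der_restr_comp.

Lemma der_is_sheaf : is_sheaf (psh_of_mpsh (der_mpsh)).
Proof.
move=> U I V hV cov.
have sep (W : opens X) (h : W `<=` U) (r s : O W) :
    (forall i, rres O (@opensIl X W (V i)) r = rres O (@opensIl X W (V i)) s) -> r = s.
  have [|+ _] := lrs_is_sheaf X W I _ (fun i => @opensIl X W (V i)); last exact.
  by move=> x Wx; have [i _ Vix] := cov x (h x Wx); exists i.
split=> [D E DE|D cD].
  apply: der_eq => W h r; apply: (sep W h) => i.
  pose k := subset_trans (@opensIl X W (V i)) h.
  rewrite !(der_res _ _ _ k).
  have := congr1 (fun F : der (V i) => F _ (@opensIr X W (V i))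
    (rres O (@opensIl X W (V i)) r)) (DE i).
  by rewrite /= !(der_fun_irr _ k).
have cD' i j (W : opens X) (h : W `<=` V i) (k : W `<=` V j) (r : O W) :
    (D i : der _) W h r = (D j : der _) W k r.
  have l : W `<=` opensI (V i) (V j) by move=> x Wx; split; [exact: h|exact: k].
  have := congr1 (fun F : der (opensI (V i) (V j)) => F W l r) (cD i j).
  by rewrite /= (der_fun_irr _ h) (der_fun_irr _ k).
have glue (W : opens X) (h : W `<=` U) (r : O W) : {s : O W | forall i,
    rres O (@opensIl X W (V i)) s =
    (D i : der _) _ (@opensIr X W (V i)) (rres O (@opensIl X W (V i)) r)}.
  apply: cid; have [|_ gl] := lrs_is_sheaf X W I _ (fun i => @opensIl X W (V i)).
    by move=> x Wx; have [i _ Vix] := cov x (h x Wx); exists i.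
  apply: gl => i j /=.
  set J := opensI _ _.
  have Ji : J `<=` V i by move=> x [[]].
  have Jj : J `<=` V j by move=> x [_ []].
  have JW : J `<=` W by move=> x [[]].
  rewrite (der_res _ _ _ Ji) (der_res _ _ _ Jj).
  by rewrite !(rres_comp _ _ JW); exact: cD'.
pose E (W : opens X) (h : W `<=` U) (r : O W) := sval (glue W h r).
have EP (W : opens X) (h : W `<=` U) r i : rres O (@opensIl X W (V i)) (E W h r) =
    (D i : der _) _ (@opensIr X W (V i)) (rres O (@opensIl X W (V i)) r).
  exact: (svalP (glue W h r)).
have Eadd (W : opens X) (h : W `<=` U) r s : E W h (r + s) = E W h r + E W h s.
  by apply: (sep W h) => i; rewrite rmorphD !EP rmorphD der_add.
have Ecst (W : opens X) (h : W `<=` U) (c : R) r :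
    E W h (lrs_cst W c * r) = lrs_cst W c * E W h r.
  by apply: (sep W h) => i; rewrite rmorphM !EP rmorphM !lrs_cst_res der_cst.
have Eleib (W : opens X) (h : W `<=` U) r s :
    E W h (r * s) = E W h r * s + r * E W h s.
  by apply: (sep W h) => i; rewrite rmorphD !rmorphM !EP rmorphM der_leibniz.
have Eres (W Z : opens X) (h : W `<=` U) (k : Z `<=` W) (l : Z `<=` U) r :
    rres O k (E W h r) = E Z l (rres O k r).
  apply: (sep Z l) => i; rewrite EP.
  have m : opensI Z (V i) `<=` opensI W (V i).
    by move=> x [? ?]; split => //; exact: k.
  have n : opensI Z (V i) `<=` W by move=> x []; move=> /k.
  rewrite !(rres_comp _ _ n) -(rres_comp (@opensIl X W (V i)) m n) EP.
  by rewrite (der_res _ _ _ (@opensIr X Z (V i))) (rres_comp _ _ n).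
exists (Der Eadd Ecst Eleib Eres) => i; apply: der_eq => W k r /=.
have h : W `<=` U := subset_trans k (@hV i).
apply: (sep W h) => j; rewrite EP.
rewrite (der_res _ _ _ (subset_trans (@opensIl X W (V j)) k)).
exact: cD'.
Qed.

Definition der_sheaf : smod O := SMod der_is_sheaf.

End Der.

Section LieRinehart.
Variables (R : realType) (X : lrs R).
Notation O := (lrs_O X).

(** The real scalars act on the sections of [A] through [lrs_cst]; the anchor
    acts on a section of [O] over [U] through the component over [U] itself. *)
Record lr_struct (A : smod O) := LRStruct {
  lr_anchor : mmor A (der_sheaf X);
  lr_brk : forall U : opens X, A U -> A U -> A U;
  lr_brk_linearl : forall (U : opens X) (c : R) (a a' b : A U),
    lr_brk (lrs_cst U c *: a + a') b = lrs_cst U c *: lr_brk a b + lr_brk a' b;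
  lr_brk_linearr : forall (U : opens X) (c : R) (a b b' : A U),
    lr_brk a (lrs_cst U c *: b + b') = lrs_cst U c *: lr_brk a b + lr_brk a b';
  lr_brk_alt : forall (U : opens X) (a : A U), lr_brk a a = 0;
  lr_jacobi : forall (U : opens X) (a b c : A U),
    lr_brk a (lr_brk b c) + lr_brk b (lr_brk c a) + lr_brk c (lr_brk a b) = 0;
  lr_brk_res : forall (U V : opens X) (h : V `<=` U) (a b : A U),
    mres A h (lr_brk a b) = lr_brk (mres A h a) (mres A h b);
  lr_anchor_brk : forall (U : opens X) (a b : A U),
    lr_anchor U (lr_brk a b) = der_brk (lr_anchor U a) (lr_anchor U b);
  lr_leibniz : forall (U : opens X) (a b : A U) (u : O U),
    lr_brk a (u *: b) =
      u *: lr_brk a b + (lr_anchor U a : der U) U (@subset_refl _ U) u *: b }.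

Definition lr_act (A : smod O) (L : lr_struct A) (U : opens X) (a : A U) (u : O U) :
  O U := (lr_anchor L U a : der U) U (@subset_refl _ U) u.

Record lr := LR { lr_mod :> smod O; lr_str : lr_struct lr_mod }.

(** Comorphisms covering the identity: since both structures live on [X], the
    anchors are compared as derivations. *)
Definition is_comorphism_id (A B : smod O) (LA : lr_struct A) (LB : lr_struct B)
    (F : mmor A B) : Prop :=
  (forall (U : opens X) (a b : A U),
     F U (lr_brk LA a b) = lr_brk LB (F U a) (F U b)) /\
  (forall (U : opens X) (a : A U), lr_anchor LB U (F U a) = lr_anchor LA U a).

End LieRinehart.

Section Comorphism.
Variables (R : realType) (X Y : lrs R) (f : lrs_mor Y X).

Definition is_comorphism (A : smod (lrs_O X)) (B : smod (lrs_O Y))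
    (LA : lr_struct A) (LB : lr_struct B) (F : mmor A (pushforward f B)) : Prop :=
  (forall (U : opens X) (a b : A U),
     F U (lr_brk LA a b) = lr_brk LB (F U a : B (preimo f U)) (F U b)) /\
  (forall (U : opens X) (a : A U) (r : lrs_O X U),
     rmap_sharp f U (lr_act LA a r) =
     lr_act LB (F U a : B (preimo f U)) (rmap_sharp f U r)).

Definition pullback (A : smod (lrs_O X)) : smod (lrs_O Y) :=
  SMod (@pullback_is_sheaf _ _ _ _ (lrs_is_sheaf Y) f A).

Definition pb_unit_fun (A : smod (lrs_O X)) (U : opens X) (a : A U) :
    pushforward f (pullback A) U :=
  pb_tensor (lrs_is_sheaf Y) (@subset_refl _ (preimo f U)) 1 a.

Lemma pb_unit_linear (A : smod (lrs_O X)) (U : opens X) : linear (@pb_unit_fun A U).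
Proof.
move=> r a b; rewrite /pb_unit_fun pb_tensorDr pb_tensor_bal mul1r rres_id.
congr (_ + _); rewrite -[X in pb_tensor _ _ X _]mulr1 -pb_tensorZ.
by [].
Qed.

Lemma pb_unit_res (A : smod (lrs_O X)) (U V : opens X) (h : V `<=` U) (a : A U) :
  pb_unit_fun (mres A h a) = mres (pushforward f (pullback A)) h (pb_unit_fun a).
Proof.
symmetry; rewrite [LHS](pb_tensor_res _ _ (@subset_refl _ (preimo f V)) (preimoS h) h).
by rewrite rmorph1.
Qed.

Definition pb_unit (A : smod (lrs_O X)) : mmor A (pushforward f (pullback A)) :=
  MMor (@pb_unit_linear A) (@pb_unit_res A).

(** [L] is the Lie-Rinehart structure induced by [alpha], characterized by its
    action on local sections [s1 (x) a] and by [a |-> 1 (x) a] being a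
    comorphism. *)
Definition induced_by (A : smod (lrs_O X)) (LA : lr_struct A)
    (alpha : mmor A (pushforward f (der_sheaf Y))) (L : lr_struct (pullback A)) : Prop :=
  (forall (U : opens X) (V : opens Y) (h : V `<=` preimo f U) (a : A U)
      (s1 s2 : lrs_O Y V),
     lr_act L (pb_tensor (lrs_is_sheaf Y) h s1 a : pullback A V) s2 =
     s1 * (alpha U a : der (preimo f U)) V h s2) /\
  is_comorphism LA L (pb_unit A).

End Comorphism.

(* Main.v *)
From HB Require Import structures.
Require Import Defs.
From mathcomp Require Import all_boot all_order all_algebra.
From mathcomp Require Import all_classical reals topology.

Set Implicit Arguments.
Unset Strict Implicit.
Unset Printing Implicit Defensive.

Import GRing.Theory.
Local Open Scope classical_set_scope.
Local Open Scope ring_scope.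

(** The map [Fbar] is forced on the elements [1 (x) a], where it must be [F a],
    hence by linearity [Fbar (s (x) a) = s F(a)]. Everything rests on two facts
    about the pullback [f^* A].

    Universal property: the formula [s (x) a |-> s F(a)] does define a morphism.
    The pullback is built in layers, colimit over the open sets containing
    [f(V)], sheafification, tensor product, sheafification again; a map into
    the sheaf [B] is extended through each layer in turn ([minv_psh_lift],
    [minv_lift], [tens_psh_lift], [pullback_lift]). The two steps through a
    sheafification keep additivity and semilinearity because the extension of a
    presheaf morphism commutes with any operation that the presheaf morphism
    commutes with ([sh_ext_op]).

    Local generation: every section of [f^* A] is locally an [O_Y]-linear
    combination of sections [1 (x) a]. This is stated as an induction principle,
    [pullback_ind]. Uniqueness follows at once ([pullback_mmor_eq]), and so does
    compatibility with the anchors, since both anchors are [O_Y]-linear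
    ([pullback_anchor_compat]). Once the anchors agree, the defect
    [Fbar [t, u] - [Fbar t, Fbar u]] is [O_Y]-bilinear, because the two
    derivative terms of the Leibniz rule cancel; so it suffices that it vanish
    on pairs [1 (x) a], [1 (x) b] ([pullback_brk_compat]). There the bracket is
    [1 (x) [a, b]] and the claim is that [F] preserves brackets. *)

(** * Sheafification and operations on presheaves *)

Section Locality.
Variable X : topologicalType.

Lemma sheaf_eq_local (P : psh X) (hP : is_sheaf P) (U : opens X) (s t : P U) :
  (forall x, U x -> exists (V : opens X) (h : V `<=` U),
     V x /\ pres P h s = pres P h t) -> s = t.
Proof.
move=> loc; apply: (sheaf_stalk_inj hP) => x Ux.
have [V [h [Vx e]]] := loc x Ux.
by rewrite -(germ_at_res h Vx) e (germ_at_res h Vx).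
Qed.

Lemma shsec_local (P : psh X) (U : opens X) (s : shsec P U) x : U x ->
  exists (V : opens X) (h : V `<=` U) (a : P V), V x /\ shres h s = sh_of a.
Proof.
move=> Ux; have [V [h [a [Vx e]]]] := shf_loc s Ux.
by exists V, h, a; split => //; apply: shsec_eq => y Vy; rewrite /= e.
Qed.

Variables P1 P2 P3 Q1 Q2 Q3 : psh X.
Hypotheses (hQ1 : is_sheaf Q1) (hQ2 : is_sheaf Q2) (hQ3 : is_sheaf Q3).
Variable c1 : forall U : opens X, P1 U -> Q1 U.
Variable c2 : forall U : opens X, P2 U -> Q2 U.
Variable c3 : forall U : opens X, P3 U -> Q3 U.
Hypothesis c1_res : forall (U V : opens X) (h : V `<=` U) s,
  pres Q1 h (c1 s) = c1 (pres P1 h s).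
Hypothesis c2_res : forall (U V : opens X) (h : V `<=` U) s,
  pres Q2 h (c2 s) = c2 (pres P2 h s).
Hypothesis c3_res : forall (U V : opens X) (h : V `<=` U) s,
  pres Q3 h (c3 s) = c3 (pres P3 h s).
Variable op : forall U : opens X, P1 U -> P2 U -> P3 U.
Variable op' : forall U : opens X, Q1 U -> Q2 U -> Q3 U.
Hypothesis op_res : forall (U V : opens X) (h : V `<=` U) s t,
  pres P3 h (op s t) = op (pres P1 h s) (pres P2 h t).
Hypothesis op'_res : forall (U V : opens X) (h : V `<=` U) s t,
  pres Q3 h (op' s t) = op' (pres Q1 h s) (pres Q2 h t).
Hypothesis c_op : forall (U : opens X) (s : P1 U) (t : P2 U),
  c3 (op s t) = op' (c1 s) (c2 t).

(** Near each point both sections come from the presheaves, where the claim is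
    the hypothesis [c_op]; the target is a sheaf, so local equality suffices.
    Addition and scalar multiplication are both instances. *)
Lemma sh_ext_op (U : opens X) (s : shsec P1 U) (t : shsec P2 U) :
  sh_ext hQ3 c3_res (sh_op op_res s t) =
  op' (sh_ext hQ1 c1_res s) (sh_ext hQ2 c2_res t).
Proof.
apply: (sheaf_eq_local hQ3) => x Ux.
have [V [h [a [Vx ea]]]] := shsec_local s Ux.
have [W [k [b [Wx eb]]]] := shsec_local t Ux.
pose J := opensI V W.
have JU : J `<=` U by exact: subset_trans (@opensIl X V W) h.
exists J, JU; split => //.
have sJ : shres JU s = sh_of (pres P1 (@opensIl X V W) a).
  by rewrite sh_of_res -ea (shres_comp h (@opensIl X V W) JU).
have tJ : shres JU t = sh_of (pres P2 (@opensIr X V W) b).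
  by rewrite sh_of_res -eb (shres_comp k (@opensIr X V W) JU).
rewrite op'_res !sh_ext_res sJ tJ.
have -> : shres JU (sh_op op_res s t) =
    sh_of (op (pres P1 (@opensIl X V W) a) (pres P2 (@opensIr X V W) b)).
  apply: shsec_eq => y Jy; rewrite -[RHS](germ_opE op_res).
  by rewrite -[germ _ _](congr1 (fun u : shsec P1 J => u y Jy) sJ)
             -[X in germ_op _ _ X](congr1 (fun u : shsec P2 J => u y Jy) tJ).
by rewrite !sh_ext_of c_op.
Qed.
End Locality.

Lemma sh_extD (X : topologicalType) (P Q : psh X) (hQ : is_sheaf Q)
    (c : forall U : opens X, P U -> Q U)
    (c_res : forall (U V : opens X) (h : V `<=` U) s,
      pres Q h (c U s) = c V (pres P h s)) :
  (forall (U : opens X), {morph c U : s t / s + t}) ->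
  forall (U : opens X) (s t : shsec P U),
    sh_ext hQ c_res (s + t) = sh_ext hQ c_res s + sh_ext hQ c_res t.
Proof.
move=> cD U s t.
exact: (@sh_ext_op X P P P Q Q Q hQ hQ hQ c c c c_res c_res c_res
  (fun U => +%R) (fun U => +%R) (@add_res X P) (@add_res X Q) cD).
Qed.

Lemma sh_ext_scale (X : topologicalType) (O O' : rpsh X) (M : mpsh O) (N : mpsh O')
    (hO' : is_sheaf (psh_of_rpsh O')) (hN : is_sheaf (psh_of_mpsh N))
    (c1 : forall U : opens X, O U -> O' U) (c2 : forall U : opens X, M U -> N U)
    (c1_res : forall (U V : opens X) (h : V `<=` U) s,
      rres O' h (c1 U s) = c1 V (rres O h s))
    (c2_res : forall (U V : opens X) (h : V `<=` U) s,
      mres N h (c2 U s) = c2 V (mres M h s)) :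
  (forall (U : opens X) r m, c2 U (r *: m) = c1 U r *: c2 U m) ->
  forall (U : opens X) (r : rshsec O U) (m : mshsec M U),
    sh_ext (P := psh_of_mpsh M) (Q := psh_of_mpsh N) hN c2_res (r *: m) =
    (sh_ext (P := psh_of_rpsh O) (Q := psh_of_rpsh O') hO' c1_res r : O' U) *:
    (sh_ext (P := psh_of_mpsh M) (Q := psh_of_mpsh N) hN c2_res m : N U).
Proof.
move=> cZ U r m.
exact: (@sh_ext_op X (psh_of_rpsh O) (psh_of_mpsh M) (psh_of_mpsh M)
  (psh_of_rpsh O') (psh_of_mpsh N) (psh_of_mpsh N) hO' hN hN c1 c2 c2
  c1_res c2_res c2_res (fun U (r : O U) (m : M U) => r *: m)
  (fun U (r : O' U) (m : N U) => r *: m) (@mres_scale X O M) (@mres_scale X O' N) cZ).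
Qed.

(** * The universal property of the pullback *)

Lemma mmorD (Z : topologicalType) (O : rpsh Z) (M N : mpsh O) (G : mmor M N)
  (U : opens Z) : {morph G U : s t / s + t}.
Proof. by move=> s t; have := mmor_linear G 1 s t; rewrite !scale1r. Qed.

Lemma mmor0 (Z : topologicalType) (O : rpsh Z) (M N : mpsh O) (G : mmor M N)
  (U : opens Z) : G U 0 = 0.
Proof. by apply: (addrI (G U 0)); rewrite -mmorD !addr0. Qed.

Lemma mmorZ (Z : topologicalType) (O : rpsh Z) (M N : mpsh O) (G : mmor M N)
  (U : opens Z) r (s : M U) : G U (r *: s) = r *: G U s.
Proof. by rewrite -[r *: s]addr0 mmor_linear mmor0 addr0. Qed.

Section PullbackLift.
Variables (X Y : topologicalType) (OX : rpsh X) (OY : rpsh Y).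
Variables (hOY : is_sheaf (psh_of_rpsh OY)) (f : rmap OX OY).
Variables (A : mpsh OX) (B : mpsh OY) (hB : is_sheaf (psh_of_mpsh B)).
Variable F : mmor A (pushforward f B).

(** The map [f^-1 A -> B] adjoint to [F], on the presheaf inverse image: a germ
    of [a] along [f(V)] goes to the restriction of [F a] to [V]. *)
Definition minv_psh_lift (V : opens Y) : minv_psh f A V -> B V :=
  germ_lift (P := psh_of_mpsh A) (fun (U : opens X) (h : f @` V `<=` U) a =>
    mres B (sub_preimo h : V `<=` preimo f U) (F U a)).

Lemma minv_psh_liftE (V : opens Y) (U : opens X) (h : f @` V `<=` U)
    (k : V `<=` preimo f U) (a : A U) :
  minv_psh_lift (mgerm h a) = mres B k (F U a).
Proof.
rewrite /minv_psh_lift /mgerm germ_liftE; first by rewrite (Prop_irrelevance (sub_preimo h) k).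
move=> {h k a} {}U W h k WU a /=; rewrite (mmor_res F).
exact: (@mres_comp _ _ B _ _ _ (preimoS WU)).
Qed.

Lemma minv_psh_lift_res (V W : opens Y) (h : W `<=` V) (g : minv_psh f A V) :
  mres B h (minv_psh_lift g) = minv_psh_lift (mres (minv_psh f A) h g).
Proof.
have [U [k [a ->]]] := germP g; rewrite -!/(mgerm k _).
pose l := subset_trans (imageS h) k.
rewrite [mres (minv_psh f A) h _](mgerm_restrE _ _ l) (minv_psh_liftE _ (sub_preimo k)).
by rewrite (mres_comp _ _ (sub_preimo l)) (minv_psh_liftE _ (sub_preimo l)).
Qed.

Lemma minv_psh_liftD (V : opens Y) (g g' : minv_psh f A V) :
  minv_psh_lift (g + g') = minv_psh_lift g + minv_psh_lift g'.
Proof.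
have [U [h [a [b [-> ->]]]]] := germP2 g g'; rewrite -!/(mgerm h _).
by rewrite mgerm_add !(minv_psh_liftE _ (sub_preimo h)) mmorD raddfD.
Qed.

Lemma minv_psh_liftZ (V : opens Y) (r : rinv_psh f OX V) (g : minv_psh f A V) :
  minv_psh_lift (r *: g) = rinv_psh_sharp r *: minv_psh_lift g.
Proof.
have [U [h [a [b [-> ->]]]]] := germP2 r g.
rewrite -!/(mgerm h _) -!/(rgerm h _) -mgerm_scale.
rewrite !(minv_psh_liftE _ (sub_preimo h)) (rinv_psh_sharpE _ (sub_preimo h)).
by rewrite mmorZ mres_scale.
Qed.

Definition minv_lift (V : opens Y) (m : minv f A V) : B V :=
  sh_ext (P := psh_of_mpsh (minv_psh f A)) hB minv_psh_lift_res m.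

Lemma minv_lift_res (V W : opens Y) (h : W `<=` V) (m : minv f A V) :
  mres B h (minv_lift m) = minv_lift (mres (minv f A) h m).
Proof. exact: (sh_ext_res (P := psh_of_mpsh (minv_psh f A)) hB). Qed.

Lemma minv_liftD (V : opens Y) (m m' : minv f A V) :
  minv_lift (m + m') = minv_lift m + minv_lift m'.
Proof.
exact: (sh_extD (P := psh_of_mpsh (minv_psh f A)) hB _ minv_psh_liftD).
Qed.

(** [minv_lift] is linear over [f^-1 O_X], acting on [B] through [f^#]; this is
    what makes [l, m |-> l *: minv_lift m] balanced. *)
Lemma minv_liftZ (V : opens Y) (r : rinv f OX V) (m : minv f A V) :
  minv_lift (r *: m) = rinv_sharp hOY f V r *: minv_lift m.
Proof.
exact: (sh_ext_scale hOY hB (@rinv_psh_sharp_res _ _ _ _ f) _ minv_psh_liftZ).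
Qed.

Definition tens_psh_lift (V : opens Y) : tens_psh hOY f A V -> B V :=
  tens_lift (fun l m => l *: minv_lift m).

Let bDl (V : opens Y) (l l' : OY V) (m : minv f A V) :
  (l + l') *: minv_lift m = l *: minv_lift m + l' *: minv_lift m.
Proof. exact: scalerDl. Qed.

Let bDr (V : opens Y) (l : OY V) (m m' : minv f A V) :
  l *: minv_lift (m + m') = l *: minv_lift m + l *: minv_lift m'.
Proof. by rewrite minv_liftD scalerDr. Qed.

Let b_bal (V : opens Y) (l : OY V) (k : rinv f OX V) (m : minv f A V) :
  (l * rinv_sharp hOY f V k) *: minv_lift m = l *: minv_lift (k *: m).
Proof. by rewrite minv_liftZ scalerA. Qed.

Lemma tens_psh_lift_pure (V : opens Y) (l : OY V) (m : minv f A V) :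
  tens_psh_lift (tpure _ l m) = l *: minv_lift m.
Proof. exact: (tens_lift_pure (@bDl V) (@bDr V) (@b_bal V)). Qed.

HB.instance Definition _ (V : opens Y) :=
  GRing.isZmodMorphism.Build (tens_psh hOY f A V) (B V) (@tens_psh_lift V)
    (tens_lift_is_additive (@bDl V) (@bDr V) (@b_bal V)).

Lemma tens_psh_lift_res (V W : opens Y) (h : W `<=` V) (t : tens_psh hOY f A V) :
  mres B h (tens_psh_lift t) = tens_psh_lift (mres (tens_psh hOY f A) h t).
Proof.
elim/tens_ind: t => [|t u ht hu|l m]; first by rewrite !raddf0.
  by rewrite !raddfD /= ht hu.
rewrite tens_psh_lift_pure mres_scale minv_lift_res.
by rewrite [X in tens_psh_lift X]tens_res_pure tens_psh_lift_pure.
Qed.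

Lemma tens_psh_liftZ (V : opens Y) (r : OY V)
    (t : tens (rinv_sharp hOY f V) (minv f A V)) :
  tens_psh_lift (r *: t) = r *: tens_psh_lift t.
Proof.
elim/tens_ind: t => [|t u ht hu|l m].
- by rewrite (scaler0 _ r) !(raddf0 (@tens_psh_lift V)) scaler0.
- by rewrite (scalerDr r) !raddfD /= ht hu.
- by rewrite tpureZ !tens_psh_lift_pure scalerA.
Qed.

Definition pullback_lift_fun (V : opens Y) (t : pullback_mpsh hOY f A V) : B V :=
  sh_ext (P := psh_of_mpsh (tens_psh hOY f A)) hB tens_psh_lift_res t.

Lemma pullback_lift_linear (V : opens Y) : linear (@pullback_lift_fun V).
Proof.
move=> r t u; rewrite /pullback_lift_fun.
rewrite [LHS](sh_extD (P := psh_of_mpsh (tens_psh hOY f A)) hB).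
  congr (_ + _).
  (* A scalar of [OY] acts through its image in the sheafification of [OY],
     which the extension of the identity sends back to the scalar itself. *)
  rewrite [LHS](sh_ext_scale (M := tens_psh hOY f A) hOY hB
    (c1 := fun _ s => s) (fun _ _ _ _ => erefl) _ tens_psh_liftZ).
  by congr (_ *: _); exact: (sh_ext_of hOY).
by move=> U v w; exact: raddfD.
Qed.

Lemma pullback_lift_res (V W : opens Y) (h : W `<=` V) (t : pullback_mpsh hOY f A V) :
  pullback_lift_fun (mres (pullback_mpsh hOY f A) h t) =
  mres B h (pullback_lift_fun t).
Proof. by symmetry; exact: (sh_ext_res (P := psh_of_mpsh (tens_psh hOY f A)) hB). Qed.

Definition pullback_lift : mmor (pullback_mpsh hOY f A) B :=
  MMor pullback_lift_linear pullback_lift_res.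

Lemma pullback_lift_tensor (U : opens X) (V : opens Y) (h : V `<=` preimo f U)
    (s : OY V) (a : A U) :
  pullback_lift V (pb_tensor hOY h s a) = s *: mres B h (F U a).
Proof.
rewrite [LHS](sh_ext_of (P := psh_of_mpsh (tens_psh hOY f A)) hB).
rewrite [LHS]tens_psh_lift_pure; congr (_ *: _).
rewrite [LHS](sh_ext_of (P := psh_of_mpsh (minv_psh f A)) hB).
exact: minv_psh_liftE.
Qed.

End PullbackLift.

(** * Local generation of the pullback *)

Section LocalGeneration.
Variables (X Y : topologicalType) (OX : rpsh X) (OY : rpsh Y).
Variables (hOY : is_sheaf (psh_of_rpsh OY)) (f : rmap OX OY) (A : mpsh OX).
Notation fA := (pullback_mpsh hOY f A).

(** The sections [1 (x) a] generate the pullback locally: a section comes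
    locally from a tensor [sum_i l_i (x) m_i], and on a smaller open set each
    [m_i] is the germ of a section [a_i], so that
    [l_i (x) m_i = l_i *: (1 (x) a_i)]. *)
Lemma pullback_ind (Q : forall V : opens Y, fA V -> Prop) :
  (forall V : opens Y, Q V 0) ->
  (forall (V : opens Y) (t u : fA V), Q V t -> Q V u -> Q V (t + u)) ->
  (forall (V : opens Y) (r : OY V) (t : fA V), Q V t -> Q V (r *: t)) ->
  (forall (U : opens X) (V : opens Y) (h : V `<=` preimo f U) (a : A U),
     Q V (pb_tensor hOY h 1 a)) ->
  (forall (V : opens Y) (t : fA V), (forall y, V y -> exists (W : opens Y) (h : W `<=` V),
     W y /\ Q W (mres fA h t)) -> Q V t) ->
  forall (V : opens Y) (t : fA V), Q V t.
Proof.
move=> Q0 QD QZ Qu Qloc V t; apply: (Qloc) => y Vy.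
have [W [h [t0 [Wy e]]]] := @shsec_local _ (psh_of_mpsh (tens_psh hOY f A)) _ t y Vy.
exists W, h; split => //; rewrite [mres fA h t]e.
elim/tens_ind: t0 {e} => [|t0 u ht hu|l m].
- by rewrite -[sh_of _]/(0 : fA W).
- by rewrite (raddfD (@sh_of _ (psh_of_mpsh (tens_psh hOY f A)) W)); exact: QD.
- apply: (Qloc W) => z Wz.
  have [Z [k [g [Zz eg]]]] := @shsec_local _ (psh_of_mpsh (minv_psh f A)) _ m z Wz.
  exists Z, k; split => //.
  rewrite [mres fA k _](esym (@sh_of_res Y (psh_of_mpsh (tens_psh hOY f A)) _ _ k _)).
  rewrite [pres _ k _](tens_res_pure hOY k l m) [X in tpure _ _ X]eg.
  have [U [j [a ->]]] := germP g.
  rewrite (Prop_irrelevance j (sub_image (sub_preimo j))).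
  rewrite -[sh_of _]/(pb_tensor hOY (sub_preimo j) _ a).
  by rewrite -[rres _ _ _]mulr1 -pb_tensorZ; exact/QZ/Qu.
Qed.

Lemma pullback_mmor_eq (B : mpsh OY) (hB : is_sheaf (psh_of_mpsh B)) (G H : mmor fA B) :
  (forall (U : opens X) (a : A U),
     G (preimo f U) (pb_tensor hOY (@subset_refl _ (preimo f U)) 1 a) =
     H (preimo f U) (pb_tensor hOY (@subset_refl _ (preimo f U)) 1 a)) ->
  G = H.
Proof.
move=> GH; apply: mmor_eq; apply: pullback_ind => [V|V t u|V r t|U V h a|V t loc].
- by rewrite !mmor0.
- by rewrite !mmorD => -> ->.
- by rewrite !mmorZ => ->.
- have e : pb_tensor hOY h 1 a =
      mres fA h (pb_tensor hOY (@subset_refl _ (preimo f U)) 1 a).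
    rewrite (pb_tensor_res _ _ h _ (@subset_refl _ U)) rmorph1; congr pb_tensor.
    by rewrite mres_id.
  by rewrite e !mmor_res GH.
- apply: (sheaf_eq_local hB) => y Vy; have [W [h [Wy e]]] := loc y Vy.
  by exists W, h; split => //; rewrite /= -!mmor_res.
Qed.

End LocalGeneration.

(** * Lie-Rinehart structures and morphisms out of the pullback *)

Section LieRinehartTheory.
Variables (R : realType) (X : lrs R) (A : smod (lrs_O X)) (L : lr_struct A).
Variable U : opens X.
Implicit Types (a b : A U) (u : lrs_O X U).

Lemma lr_brkDl a a' b : lr_brk L (a + a') b = lr_brk L a b + lr_brk L a' b.
Proof. by have := lr_brk_linearl L 1 a a' b; rewrite rmorph1 !scale1r. Qed.

Lemma lr_brkDr a b b' : lr_brk L a (b + b') = lr_brk L a b + lr_brk L a b'.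
Proof. by have := lr_brk_linearr L 1 a b b'; rewrite rmorph1 !scale1r. Qed.

Lemma lr_brk0l b : lr_brk L 0 b = 0.
Proof. by apply: (addrI (lr_brk L 0 b)); rewrite -lr_brkDl !addr0. Qed.

Lemma lr_brk0r a : lr_brk L a 0 = 0.
Proof. by apply: (addrI (lr_brk L a 0)); rewrite -lr_brkDr !addr0. Qed.

Lemma lr_brkC a b : lr_brk L a b = - lr_brk L b a.
Proof.
apply/eqP; rewrite -addr_eq0; apply/eqP.
have := lr_brk_alt L (a + b).
by rewrite lr_brkDl !lr_brkDr !lr_brk_alt add0r addr0.
Qed.

Lemma lr_brkZr a u b : lr_brk L a (u *: b) = u *: lr_brk L a b + lr_act L a u *: b.
Proof. exact: lr_leibniz. Qed.

Lemma lr_brkZl u a b : lr_brk L (u *: a) b = u *: lr_brk L a b - lr_act L b u *: a.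
Proof. by rewrite lr_brkC lr_brkZr opprD -scalerN -lr_brkC. Qed.

End LieRinehartTheory.

(** A derivation over [U] carries its values on all smaller open sets; for an
    anchor these are already given by the action of the restricted section. *)
Lemma lr_anchorE (R : realType) (X : lrs R) (A : smod (lrs_O X)) (L : lr_struct A)
    (U V : opens X) (h : V `<=` U) (a : A U) (u : lrs_O X V) :
  (lr_anchor L U a : der U) V h u = lr_act L (mres A h a) u.
Proof. by rewrite /lr_act mmor_res /=; exact: der_fun_irr. Qed.

Section ComorphismLift.
Variables (R : realType) (X Y : lrs R) (f : lrs_mor Y X).
Variables (A : smod (lrs_O X)) (B : smod (lrs_O Y)).
Variables (L : lr_struct (pullback f A)) (LB : lr_struct B).
Notation fA := (pullback f A).
Notation unit h a := (pb_tensor (lrs_is_sheaf Y) h 1 a).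
Variable G : mmor fA B.

Lemma pullback_anchor_compat :
  (forall (U : opens X) (V : opens Y) (h : V `<=` preimo f U) (a : A U) s,
     lr_act L (unit h a : fA V) s = lr_act LB (G V (unit h a)) s) ->
  forall (V : opens Y) (t : fA V), lr_anchor LB V (G V t) = lr_anchor L V t.
Proof.
move=> GL; apply: pullback_ind => [V|V t u|V r t|U V h a|V t loc].
- by rewrite !mmor0.
- by rewrite !mmorD => -> ->.
- by rewrite !mmorZ => ->.
- apply: der_eq => W k s; rewrite !lr_anchorE -mmor_res.
  by rewrite (pb_tensor_res _ _ (subset_trans k h) _ (@subset_refl _ U)) rmorph1 GL.
- apply: (sheaf_eq_local (@der_is_sheaf _ Y)) => y Vy; have [W [h [Wy e]]] := loc y Vy.
  exists W, h; split => //.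
  by rewrite -[LHS]mmor_res -[RHS]mmor_res -mmor_res.
Qed.

Hypothesis G_anchor : forall (V : opens Y) (t : fA V),
  lr_anchor LB V (G V t) = lr_anchor L V t.

Let G_act (V : opens Y) (t : fA V) s : lr_act LB (G V t) s = lr_act L t s.
Proof. by rewrite /lr_act G_anchor. Qed.

(** Equal anchors make the derivative terms in the expansions of
    [G [r t, u]] and [[r G t, G u]] agree, so the condition is stable under
    scaling in each argument, and induction on both arguments applies. *)
Lemma pullback_brk_compat :
  (forall (U : opens X) (a b : A U),
     let e := @subset_refl _ (preimo f U) in
     G _ (lr_brk L (unit e a : fA (preimo f U)) (unit e b)) =
     lr_brk LB (G _ (unit e a)) (G _ (unit e b))) ->
  forall (V : opens Y) (t u : fA V),
    G V (lr_brk L t u) = lr_brk LB (G V t) (G V u).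
Proof.
move=> Gu; apply: pullback_ind => [V|V t t' ht ht'|V r t ht|U V h a|V t loc] u.
- by rewrite mmor0 !lr_brk0l mmor0.
- by rewrite mmorD !lr_brkDl mmorD ht ht'.
- by rewrite mmorZ !lr_brkZl mmorD -scaleNr !mmorZ ht G_act scaleNr.
- move: V u U h a; apply: pullback_ind => [V|V u u' hu hu'|V r u hu|U' V k b|V u loc] U h a.
  + by rewrite mmor0 !lr_brk0r mmor0.
  + by rewrite mmorD !lr_brkDr mmorD hu hu'.
  + by rewrite mmorZ !lr_brkZr mmorD !mmorZ hu G_act.
  (* [a] lives over [U] and [b] over [U']: both are restricted to [U :&: U'],
     where the hypothesis on generators applies. *)
  + pose J := opensI U U'.
    have VJ : V `<=` preimo f J by move=> y Vy; split; [exact: h|exact: k].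
    pose e := @subset_refl _ (preimo f J).
    have -> : unit h a = mres fA VJ (unit e (mres A (@opensIl X U U') a)).
      rewrite -(mres_id (@subset_refl _ V) (unit h a)).
      rewrite (pb_tensor_res _ _ VJ _ (@opensIl X U U')).
      by rewrite (pb_tensor_res _ _ VJ _ (@subset_refl _ J)) !rmorph1 mres_id.
    have -> : unit k b = mres fA VJ (unit e (mres A (@opensIr X U U') b)).
      rewrite -(mres_id (@subset_refl _ V) (unit k b)).
      rewrite (pb_tensor_res _ _ VJ _ (@opensIr X U U')).
      by rewrite (pb_tensor_res _ _ VJ _ (@subset_refl _ J)) !rmorph1 mres_id.
    by rewrite -lr_brk_res !mmor_res Gu lr_brk_res.
  + apply: (sheaf_eq_local (smod_is_sheaf B)) => y Vy.
    have [W [l [Wy e]]] := loc y Vy; exists W, l; split => //.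
    rewrite -[LHS]mmor_res [RHS]lr_brk_res lr_brk_res -!mmor_res.
    by rewrite (pb_tensor_res _ _ (subset_trans l h) _ (@subset_refl _ U)) rmorph1 e.
- apply: (sheaf_eq_local (smod_is_sheaf B)) => y Vy.
  have [W [l [Wy e]]] := loc y Vy; exists W, l; split => //.
  by rewrite -[LHS]mmor_res [RHS]lr_brk_res lr_brk_res -!mmor_res e.
Qed.

End ComorphismLift.

Theorem theorem5p8 (R : realType) (X Y : lrs R) (A : lr X) (B : lr Y)
    (f : lrs_mor Y X) (F : mmor A (pushforward f B))
    (HF : is_comorphism (lr_str A) (lr_str B) F)
    (L : lr_struct (pullback f A))
    (HL : induced_by (lr_str A)
            (mcomp (pushf_mmor f (lr_anchor (lr_str B))) F) L) :
  exists! Fbar : mmor (pullback f A) B,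
    is_comorphism_id L (lr_str B) Fbar /\
    F = mcomp (pushf_mmor f Fbar) (pb_unit f A).
Proof.
have [FB _] := HF; have [Lact [Lbrk _]] := HL.
pose G : mmor (pullback f A) B := pullback_lift (lrs_is_sheaf Y) (smod_is_sheaf B) F.
have Gt (U : opens X) (V : opens Y) (h : V `<=` preimo f U) (a : A U) :
    G V (pb_tensor (lrs_is_sheaf Y) h 1 a) = mres B h (F U a).
  by rewrite pullback_lift_tensor scale1r.
have Gu (U : opens X) (a : A U) : G (preimo f U) (pb_unit f A U a) = F U a.
  by rewrite [LHS]Gt mres_id.
exists G; split.
  split; last by apply: mmor_eq => U a; exact/esym/Gu.
  have Ganchor : forall (V : opens Y) (t : pullback f A V),
      lr_anchor (lr_str B) V (G V t) = lr_anchor L V t.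
    apply: pullback_anchor_compat => U V h a s.
    by rewrite Lact Gt mul1r -lr_anchorE.
  split=> //; apply: (pullback_brk_compat Ganchor) => U a b e.
  rewrite -[X in lr_brk L X _]/(pb_unit f A U a) -[X in lr_brk L _ X]/(pb_unit f A U b).
  by rewrite -Lbrk [LHS]Gu FB !Gt !mres_id.
move=> H [_ FH]; apply: (pullback_mmor_eq (smod_is_sheaf B)) => U a.
by rewrite -[RHS](congr1 (fun K : mmor A (pushforward f B) => K U a) FH); exact: Gu.
Qed.
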